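(* Let $R$ be a noetherian local ring with residue field $k$ of characteristic $p>0$. If $pR\neq 0$, then there exist $0$-dimensional Gorenstein $k$-schemes that are not liftable to the canonical projection $R\to k$.
   Context: For a surjective ring homomorphism $R\to k$ onto a field $k$, a $k$-scheme $X$ is called liftable to $R\to k$ (or to $R$) if there exist a flat $R$-scheme $\tilde X$ and a closed embedding $X\hookrightarrow \tilde X$ inducing an isomorphism $X\to \tilde X\times_{\operatorname{Spec} R}\operatorname{Spec} k$. *)

(* Defs.v *)
From HB Require Import structures.
From mathcomp Require Import all_boot all_order all_algebra.
From mathcomp Require Import generic_quotient ring_quotient.
From mathcomp Require Import boolp classical_sets topology_structure.
From mathcomp Require Import ring.

Set Implicit Arguments.
Unset Strict Implicit.
Unset Printing Implicit Defensive.

Import GRing.Theory.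

Local Open Scope quotient_scope.
Local Open Scope classical_set_scope.
Local Open Scope ring_scope.

Section Rings.
Variable A : comNzRingType.

Definition is_unit (a : A) : Prop := exists b : A, a * b = 1.

(* [idealr A] is the library's type of proper ideals, so that maximality is
   meant among proper ideals. *)
Definition maximal_ideal (m : idealr A) : Prop :=
  forall J : idealr A, {subset m <= J} -> {subset J <= m}.

Definition local_ring : Prop :=
  exists2 m : idealr A, maximal_ideal m &
    forall m' : idealr A, maximal_ideal m' -> m' =i m.

(* The improper ideal, absent from [idealr A], is generated by 1. *)
Definition noetherian : Prop :=
  forall I : idealr A, exists s : seq A,
    forall a, a \in I <-> exists c : nat -> A, a = \sum_(i < size s) c i * s`_i.

End Rings.

Definition local_hom (A B : comNzRingType) (phi : {rmorphism A -> B}) : Prop :=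
  forall a, is_unit (phi a) -> is_unit a.

Section Modules.
Variable A : comNzRingType.

Definition injective_module (I : lmodType A) : Prop :=
  forall (M N : lmodType A) (u : {linear M -> N}) (f : {linear M -> I}),
    injective u -> exists g : {linear N -> I}, forall x, g (u x) = f x.

(* There is an exact sequence 0 -> M -> I 0 -> I 1 -> I 2 -> ... of injective
   modules with I i = 0 for i > n. *)
Definition finite_injective_dimension (M : lmodType A) : Prop :=
  exists (n : nat) (I : nat -> lmodType A) (e : {linear M -> I 0%N})
         (d : forall i, {linear I i -> I i.+1}),
    [/\ forall i, injective_module (I i),
        injective e,
        forall y, d 0%N y = 0 <-> exists x, y = e x,
        forall i y, d i.+1 y = 0 <-> exists x, y = d i x
      & forall i, (n < i)%N -> forall x : I i, x = 0].

Definition gorenstein_local_ring : Prop :=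
  [/\ noetherian A, local_ring A & finite_injective_dimension A^o].

Definition is_tensor_product (M N T : lmodType A)
    (t : {bilinear M -> N -> T}) : Prop :=
  forall (Z : lmodType A) (b : {bilinear M -> N -> Z}),
    exists h : {linear T -> Z},
      (forall x y, h (t x y) = b x y) /\
      forall h' : {linear T -> Z}, (forall x y, h' (t x y) = b x y) -> h' =1 h.

(* Tensoring with N is right exact, so exactness is preservation of injections;
   [h] is u (x) id_N. *)
Definition flat_module (N : lmodType A) : Prop :=
  forall (M M' T T' : lmodType A) (u : {linear M -> M'})
         (t : {bilinear M -> N -> T}) (t' : {bilinear M' -> N -> T'})
         (h : {linear T -> T'}),
    is_tensor_product t -> is_tensor_product t' ->
    (forall x y, h (t x y) = t' (u x) y) ->
    injective u -> injective h.

End Modules.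

Definition restrict_scalars (A B : comNzRingType) (phi : {rmorphism A -> B})
  : Type := B.

Section RestrictScalars.
Variables (A B : comNzRingType) (phi : {rmorphism A -> B}).
Local Notation M := (restrict_scalars phi).

HB.instance Definition _ := GRing.Zmodule.on M.

Definition restrict_scale (a : A) (x : M) : M := phi a * (x : B).

Lemma restrict_scaleA a b x :
  restrict_scale a (restrict_scale b x) = restrict_scale (a * b) x.
Proof. by rewrite /restrict_scale rmorphM mulrA. Qed.
Lemma restrict_scale1 : left_id 1 restrict_scale.
Proof. by move=> x; rewrite /restrict_scale rmorph1 mul1r. Qed.
Lemma restrict_scaleDr : right_distributive restrict_scale +%R.
Proof. by move=> a x y; rewrite /restrict_scale mulrDr. Qed.
Lemma restrict_scaleDl x : {morph restrict_scale^~ x : a b / a + b}.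
Proof. by move=> a b; rewrite /restrict_scale rmorphD mulrDl. Qed.

HB.instance Definition _ := GRing.Zmodule_isLmodule.Build A M
  restrict_scaleA restrict_scale1 restrict_scaleDr restrict_scaleDl.
End RestrictScalars.

Definition flat_hom (A B : comNzRingType) (phi : {rmorphism A -> B}) : Prop :=
  flat_module (restrict_scalars phi : lmodType A).

Section Localization.
Variables (A : comNzRingType) (p : prime_idealr A).

Record denom : Type := Denom { den : A; denP : den \notin p }.
HB.instance Definition _ := [isSub for den].
HB.instance Definition _ := [Choice of denom by <:].

Lemma denom1_subproof : (1 : A) \notin p.
Proof. by rewrite idealr1. Qed.
Definition denom1 : denom := Denom denom1_subproof.

Lemma denomM_subproof (s t : denom) : den s * den t \notin p.
Proof. by rewrite prime_idealrM negb_or (denP s) (denP t). Qed.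
Definition denomM (s t : denom) : denom := Denom (denomM_subproof s t).

Definition loc_equiv (x y : A * denom) : bool :=
  `[< exists2 u, u \notin p &
      u * (x.1 * den y.2 - y.1 * den x.2) = 0 >].

Lemma loc_equiv_refl : reflexive loc_equiv.
Proof.
by move=> x; apply/asboolP; exists 1; rewrite ?idealr1 // subrr mulr0.
Qed.
Lemma loc_equiv_sym : symmetric loc_equiv.
Proof.
have sub x y : loc_equiv x y -> loc_equiv y x.
  move=> /asboolP[u up e]; apply/asboolP; exists u => //.
  by rewrite -opprB mulrN e oppr0.
by move=> x y; apply/idP/idP; exact: sub.
Qed.
Lemma loc_equiv_trans : transitive loc_equiv.
Proof.
move=> [b t] [a s] [c r] /asboolP[u up /= e1] /asboolP[v vp /= e2].
apply/asboolP; exists (u * v * den t).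
  by rewrite !prime_idealrM !negb_or up vp (denP t).
rewrite /= (_ : _ * _ = v * den r * (u * (a * den t - b * den s))
  + u * den s * (v * (b * den r - c * den t))); last by ring.
by rewrite e1 e2 !mulr0 addr0.
Qed.

Canonical loc_equiv_equiv :=
  EquivRel loc_equiv loc_equiv_refl loc_equiv_sym loc_equiv_trans.

Definition localization : Type := {eq_quot loc_equiv}.
HB.instance Definition _ : EqQuotient _ loc_equiv localization :=
  EqQuotient.on localization.
HB.instance Definition _ := Choice.on localization.

Definition frac (a : A) (s : denom) : localization := \pi_localization (a, s).

Lemma fracP a s b t : frac a s = frac b t <->
  exists2 u, u \notin p & u * (a * den t - b * den s) = 0.
Proof.
by split=> [/eqmodP/asboolP//|h]; apply/eqmodP/asboolP.
Qed.

Lemma fracW (P : localization -> Prop) :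
  (forall a s, P (frac a s)) -> forall x, P x.
Proof. by move=> h; elim/quotW => -[a s]; exact: h. Qed.

Definition loc_num (x : localization) : A := (repr x).1.
Definition loc_den (x : localization) : denom := (repr x).2.

Lemma loc_numden x : frac (loc_num x) (loc_den x) = x.
Proof. by rewrite /frac -surjective_pairing reprK. Qed.

Definition loc_add x y := frac
  (loc_num x * den (loc_den y) + loc_num y * den (loc_den x))
  (denomM (loc_den x) (loc_den y)).
Definition loc_opp x := frac (- loc_num x) (loc_den x).
Definition loc_mul x y :=
  frac (loc_num x * loc_num y) (denomM (loc_den x) (loc_den y)).

Lemma loc_addE a s b t :
  loc_add (frac a s) (frac b t) =
  frac (a * den t + b * den s) (denomM s t).
Proof.
have /fracP[u up e1] := loc_numden (frac a s).
have /fracP[v vp e2] := loc_numden (frac b t).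
rewrite /loc_add; apply/fracP; exists (u * v).
  by rewrite prime_idealrM negb_or up.
move: e1 e2; rewrite /=; set a' := loc_num _; set b' := loc_num _.
set s' := loc_den _; set t' := loc_den _ => e1 e2.
rewrite (_ : _ * _ = v * den t * den t' * (u * (a' * den s - a * den s'))
  + u * den s * den s' * (v * (b' * den t - b * den t'))); last by ring.
by rewrite e1 e2 !mulr0 addr0.
Qed.

Lemma loc_oppE a s : loc_opp (frac a s) = frac (- a) s.
Proof.
have /fracP[u up e1] := loc_numden (frac a s).
apply/fracP; exists u => //; rewrite -[RHS]oppr0 -[in RHS]e1; ring.
Qed.

Lemma loc_mulE a s b t :
  loc_mul (frac a s) (frac b t) = frac (a * b) (denomM s t).
Proof.
have /fracP[u up e1] := loc_numden (frac a s).
have /fracP[v vp e2] := loc_numden (frac b t).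
rewrite /loc_mul; apply/fracP; exists (u * v).
  by rewrite prime_idealrM negb_or up.
move: e1 e2; rewrite /=; set a' := loc_num _; set b' := loc_num _.
set s' := loc_den _; set t' := loc_den _ => e1 e2.
rewrite (_ : _ * _ = v * b' * den t * (u * (a' * den s - a * den s'))
  + u * a * den s' * (v * (b' * den t - b * den t'))); last by ring.
by rewrite e1 e2 !mulr0 addr0.
Qed.

Lemma frac_eq a s b t : a * den t = b * den s -> frac a s = frac b t.
Proof.
by move=> e; apply/fracP; exists 1; rewrite ?idealr1 // e subrr mulr0.
Qed.

Lemma loc_addA : associative loc_add.
Proof.
elim/fracW=> a s; elim/fracW=> b t; elim/fracW=> c r.
by rewrite !loc_addE; apply: frac_eq => /=; ring.
Qed.
Lemma loc_addC : commutative loc_add.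
Proof.
elim/fracW=> a s; elim/fracW=> b t.
by rewrite !loc_addE; apply: frac_eq => /=; ring.
Qed.
Lemma loc_add0 : left_id (frac 0 denom1) loc_add.
Proof. by elim/fracW=> a s; rewrite loc_addE; apply: frac_eq => /=; ring. Qed.
Lemma loc_addN : left_inverse (frac 0 denom1) loc_opp loc_add.
Proof.
by elim/fracW=> a s; rewrite loc_oppE loc_addE; apply: frac_eq => /=; ring.
Qed.
HB.instance Definition _ :=
  GRing.isZmodule.Build localization loc_addA loc_addC loc_add0 loc_addN.

Lemma loc_mulA : associative loc_mul.
Proof.
elim/fracW=> a s; elim/fracW=> b t; elim/fracW=> c r.
by rewrite !loc_mulE; apply: frac_eq => /=; ring.
Qed.
Lemma loc_mulC : commutative loc_mul.
Proof.
elim/fracW=> a s; elim/fracW=> b t.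
by rewrite !loc_mulE; apply: frac_eq => /=; ring.
Qed.
Lemma loc_mul1 : left_id (frac 1 denom1) loc_mul.
Proof. by elim/fracW=> a s; rewrite loc_mulE; apply: frac_eq => /=; ring. Qed.
Lemma loc_mulDl : left_distributive loc_mul loc_add.
Proof.
elim/fracW=> a s; elim/fracW=> b t; elim/fracW=> c r.
by rewrite !(loc_mulE, loc_addE); apply: frac_eq => /=; ring.
Qed.
Lemma loc_1_neq0 : frac 1 denom1 != frac 0 denom1.
Proof.
apply/eqP => /fracP[u up /=]; rewrite mul0r subr0 !mulr1 => u0.
by rewrite u0 idealr0 in up.
Qed.
HB.instance Definition _ := GRing.Zmodule_isComNzRing.Build localization
  loc_mulA loc_mulC loc_mul1 loc_mulDl loc_1_neq0.

Lemma fracD a s b t :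
  frac a s + frac b t = frac (a * den t + b * den s) (denomM s t).
Proof. exact: loc_addE. Qed.
Lemma fracN a s : - frac a s = frac (- a) s.
Proof. exact: loc_oppE. Qed.
Lemma fracM a s b t : frac a s * frac b t = frac (a * b) (denomM s t).
Proof. exact: loc_mulE. Qed.
Lemma frac0 : frac 0 denom1 = 0.
Proof. by []. Qed.
Lemma frac1 : frac 1 denom1 = 1.
Proof. by []. Qed.

Lemma frac_unit a s : is_unit (frac a s) <-> a \notin p.
Proof.
split=> [[]|ap].
  elim/fracW=> b t; rewrite fracM -frac1 => /fracP[u up /= e].
  apply/negP => ap; suff : u * (den s * den t) \in p.
    by rewrite !prime_idealrM (negPf up) (negPf (denP s)) (negPf (denP t)).
  rewrite (_ : _ * _ = (u * b) * a - u * (a * b * 1 - 1 * (den s * den t))).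
    by rewrite e subr0 idealMr.
  ring.
exists (frac (den s) (Denom ap)).
by rewrite fracM -frac1; apply: frac_eq => /=; ring.
Qed.

Definition loc_max : pred localization := fun x => `[< ~ is_unit x >].

Lemma loc_maxE a s : (frac a s \in loc_max) = (a \in p).
Proof.
apply/asboolP/idP => [nu|ap /frac_unit]; last by rewrite ap.
by apply/negPn/negP => ap; apply/nu/frac_unit.
Qed.

Lemma loc_max_idealr : idealr_closed loc_max.
Proof.
split.
- by rewrite -frac0 loc_maxE idealr0.
- by rewrite -frac1 loc_maxE idealr1.
- elim/fracW=> a s; elim/fracW=> b t; elim/fracW=> c r.
  rewrite fracM fracD !loc_maxE => bp cp.
  by apply: rpredD; rewrite mulrC idealMr // idealMr.
Qed.
HB.instance Definition _ := isIdealr.Build localization loc_max loc_max_idealr.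

Lemma localization_local : local_ring localization.
Proof.
have nu (J : idealr localization) x : x \in J -> x \in (loc_max : pred _).
  move=> xJ; apply/asboolP => -[y xy].
  by move: (idealr1 J); rewrite -xy mulrC idealMr.
exists loc_max => [J _ x|m' mm']; first exact: nu.
by move=> x; apply/idP/idP; [exact: nu | apply: mm' => y; exact: nu].
Qed.

End Localization.

Section LocalizationMap.
Variables (A B : comNzRingType) (phi : {rmorphism A -> B}) (q : prime_idealr B).

Definition comap : pred A := fun a => phi a \in q.

Lemma comap_idealr : idealr_closed comap.
Proof.
have E a : (a \in comap) = (phi a \in q) by [].
split; rewrite ?E ?rmorph0 ?idealr0 ?rmorph1 ?idealr1 //.
move=> a u v; rewrite !E rmorphD rmorphM => hu hv.
by apply: rpredD => //; exact: idealMr.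
Qed.
HB.instance Definition _ := isIdealr.Build A comap comap_idealr.

Lemma comap_prime : prime_idealr_closed comap.
Proof.
have E a : (a \in comap) = (phi a \in q) by [].
by move=> u v; rewrite !E rmorphM prime_idealrM.
Qed.
HB.instance Definition _ := isPrimeIdealrClosed.Build A comap comap_prime.

Definition prime_comap : prime_idealr A := comap.

Definition denom_map (s : denom prime_comap) : denom q :=
  @Denom B q (phi (den s)) (denP s).

Definition loc_map (x : localization prime_comap) : localization q :=
  frac (phi (loc_num x)) (denom_map (loc_den x)).

Lemma loc_mapE a s : loc_map (frac a s) = frac (phi a) (denom_map s).
Proof.
have /fracP[u up e] := loc_numden (frac a s).
apply/fracP; exists (phi u); first by [].
by rewrite /= -!rmorphM -rmorphB -rmorphM e rmorph0.
Qed.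

Lemma loc_map_zmod : zmod_morphism loc_map.
Proof.
elim/fracW=> a s; elim/fracW=> b t.
rewrite fracN fracD !loc_mapE fracN fracD; apply: frac_eq => /=.
by rewrite !(rmorphD, rmorphM, rmorphN).
Qed.
Lemma loc_map_monoid : monoid_morphism loc_map.
Proof.
split.
  by rewrite -frac1 loc_mapE -frac1; apply: frac_eq; rewrite /= rmorph1.
elim/fracW=> a s; elim/fracW=> b t.
by rewrite fracM !loc_mapE fracM; apply: frac_eq; rewrite /= !rmorphM.
Qed.
HB.instance Definition _ := GRing.isZmodMorphism.Build
  (localization prime_comap) (localization q) loc_map loc_map_zmod.
HB.instance Definition _ := GRing.isMonoidMorphism.Build
  (localization prime_comap) (localization q) loc_map loc_map_monoid.

Lemma loc_map_local : local_hom (loc_map : {rmorphism _ -> _}).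
Proof. by elim/fracW=> a s; rewrite /= loc_mapE => /frac_unit ap; apply/frac_unit. Qed.

End LocalizationMap.

(* The structure sheaf is presented by its space of germs: each section over an
   open U is identified with the family of its germs at the points of U.
   Families are total functions for convenience; by [sec_ext] only the values
   on U matter, and [sec U] is only meaningful for open U.  The fields
   [sec_res] and [sec_glue] are the presheaf and gluing axioms (uniqueness in
   the gluing axiom is automatic for families of germs); [germ_ex] and
   [germ_eq] say that [stalk x] is the colimit of the sections over the open
   neighbourhoods of x. *)
Record lrs := Lrs {
  space :> topologicalType;
  stalk : space -> comNzRingType;
  sec : set space -> set (forall x, stalk x);
  sec_ext : forall U s t, open U -> (forall x, U x -> s x = t x) ->
    sec U s -> sec U t;
  sec_res : forall U V s, open U -> open V -> V `<=` U -> sec U s -> sec V s;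
  sec_glue : forall U s, open U ->
    (forall x, U x -> exists V, [/\ open V, V x, V `<=` U & sec V s]) ->
    sec U s;
  sec1 : forall U, open U -> sec U (fun x => 1);
  secB : forall U s t, open U -> sec U s -> sec U t ->
    sec U (fun x => s x - t x);
  secM : forall U s t, open U -> sec U s -> sec U t ->
    sec U (fun x => s x * t x);
  germ_ex : forall x (a : stalk x),
    exists U s, [/\ open U, U x, sec U s & s x = a];
  germ_eq : forall U s t x, open U -> sec U s -> sec U t -> U x -> s x = t x ->
    exists V, [/\ open V, V x, V `<=` U & forall y, V y -> s y = t y];
  stalk_local : forall x, local_ring (stalk x) }.

Arguments stalk : clear implicits.
Arguments sec : clear implicits.

Record mor (X Y : lrs) := Mor {
  mor_fun :> X -> Y;
  mor_stalk : forall x, {rmorphism stalk Y (mor_fun x) -> stalk X x};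
  mor_continuous : continuous mor_fun;
  mor_sec : forall V t, open V -> sec Y V t ->
    sec X (mor_fun @^-1` V) (fun x => mor_stalk x (t (mor_fun x)));
  mor_local : forall x, local_hom (mor_stalk x) }.

(* Equality of maps of spaces and of comorphisms; ranging over all families of
   germs [t] avoids transporting along f x = g x. *)
Definition eq_mor (X Y : lrs) (f g : mor X Y) : Prop :=
  f =1 g /\
  forall x (t : forall y, stalk Y y),
    mor_stalk f x (t (f x)) = mor_stalk g x (t (g x)).

Definition mor_id (X : lrs) : mor X X.
Proof.
refine (@Mor X X id (fun x => idfun) _ _ _).
- by move=> x; exact: cvg_id.
- by move=> V t.
- by move=> x a.
Defined.

Definition mor_comp (X Y Z : lrs) (g : mor Y Z) (f : mor X Y) : mor X Z.
Proof.
refine (@Mor X Z (fun x => g (f x))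
  (fun x => mor_stalk f x \o mor_stalk g (f x)) _ _ _).
- by move=> x; apply: continuous_comp; exact: mor_continuous.
- move=> V t oV secV; apply: (@mor_sec _ _ f (g @^-1` V)
    (fun y => mor_stalk g y (t (g y)))); last exact: mor_sec.
  by have /continuousP := @mor_continuous _ _ g; apply.
- by move=> x a /mor_local/mor_local.
Defined.

Definition is_iso (X Y : lrs) (f : mor X Y) : Prop :=
  exists g : mor Y X, eq_mor (mor_comp g f) (mor_id X) /\
                      eq_mor (mor_comp f g) (mor_id Y).

(* Given [germ_ex] and [germ_eq], bijective comorphisms on stalks identify X with
   the open subspace f(X) of Y. *)
Definition open_immersion (X Y : lrs) (f : mor X Y) : Prop :=
  [/\ injective f, forall U, open U -> open (f @` U)
    & forall x, bijective (mor_stalk f x)].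

(* O_Y -> f_* O_X is surjective iff it is so on stalks, and f_* O_X has stalk
   O_X,x at f x and zero stalks outside the closed set f(X). *)
Definition closed_immersion (X Y : lrs) (f : mor X Y) : Prop :=
  [/\ injective f, forall C, closed C -> closed (f @` C)
    & forall x b, exists a, mor_stalk f x a = b].

(* The points of Spec A, i.e. the elements of [prime_idealr A]; the latter type
   itself lives in too large a universe to carry a topology. *)
Record spec (A : comNzRingType) : Type := SpecPoint {
  pideal :> A -> bool;
  pideal_idealr : idealr_closed pideal;
  pideal_prime : prime_idealr_closed pideal }.

HB.instance Definition _ (A : comNzRingType) (p : spec A) :=
  isIdealr.Build A (pideal p) (pideal_idealr p).
HB.instance Definition _ (A : comNzRingType) (p : spec A) :=
  isPrimeIdealrClosed.Build A (pideal p) (@pideal_prime A p).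

Section SpecSpace.
Variable A : comNzRingType.
Local Notation S := (spec A).

HB.instance Definition _ := gen_eqMixin S.
HB.instance Definition _ := gen_choiceMixin S.

(* The complement of the closed set V(E). *)
Definition zariski_basic (E : set A) : set S :=
  [set p : S | exists2 a, E a & a \notin pideal p].

Definition zariski_open : set_system S :=
  [set U | exists E, U = zariski_basic E].

Lemma zariski_openT : zariski_open setT.
Proof.
exists setT; apply/seteqP; split=> // p _; exists 1 => //.
by rewrite idealr1.
Qed.

Lemma zariski_openI (U V : set S) :
  zariski_open U -> zariski_open V -> zariski_open (U `&` V).
Proof.
move=> [E ->] [F ->]; exists [set c | exists a b, [/\ E a, F b & c = a * b]].
apply/seteqP; split=> p.
  move=> [[a Ea ap] [b Fb bp]]; exists (a * b); first by exists a, b.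
  by rewrite prime_idealrM negb_or ap.
move=> [_ [a [b [Ea Fb ->]]]]; rewrite prime_idealrM negb_or => /andP[ap bp].
by split; [exists a | exists b].
Qed.

Lemma zariski_open_bigU (I : Type) (f : I -> set S) :
  (forall i, zariski_open (f i)) -> zariski_open (\bigcup_i f i).
Proof.
move=> hf; exists [set a | exists i E, f i = zariski_basic E /\ E a].
apply/seteqP; split=> p.
  move=> [i _ fip]; have [E fE] := hf i; move: fip; rewrite fE => -[a Ea ap].
  by exists a => //; exists i, E.
move=> [a [i [E [fE Ea]]] ap]; exists i => //.
by rewrite fE; exists a.
Qed.

HB.instance Definition _ := isOpenTopological.Build S
  zariski_openT zariski_openI zariski_open_bigU.

Definition spec_stalk (p : S) : comNzRingType :=
  localization (pideal p).

Definition spec_sec (U : set S) : set (forall p, spec_stalk p) :=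
  [set s | forall p, U p -> exists V : set S,
    [/\ open V, V p, V `<=` U &
        exists a b : A, forall q : S, V q ->
          exists bq : b \notin pideal q,
            s q = frac a (Denom bq)]].

End SpecSpace.

Section Spec.
Variable A : comNzRingType.
Local Notation S := (spec A).
Implicit Types (U V : set S) (s t : forall p : S, spec_stalk p).

Lemma spec_sec_ext U s t : open U -> (forall x, U x -> s x = t x) ->
  spec_sec U s -> spec_sec U t.
Proof.
move=> _ st hs p Up; have [V [oV Vp VU [a [b h]]]] := hs p Up.
exists V; split=> //; exists a, b => q Vq.
by have [bq e] := h q Vq; exists bq; rewrite -st //; exact: VU.
Qed.

Lemma spec_sec_res U V s : open U -> open V -> V `<=` U ->
  spec_sec U s -> spec_sec V s.
Proof.
move=> oU oV VU hs p Vp; have [W [oW Wp WU [a [b h]]]] := hs p (VU _ Vp).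
exists (W `&` V); split=> //; first exact: openI.
by exists a, b => q [Wq _]; exact: h.
Qed.

Lemma spec_sec_glue U s : open U ->
  (forall x, U x -> exists V, [/\ open V, V x, V `<=` U & spec_sec V s]) ->
  spec_sec U s.
Proof.
move=> oU h p Up; have [V [oV Vp VU hs]] := h p Up.
have [W [oW Wp WV ab]] := hs p Vp.
by exists W; split=> //; exact: subset_trans WV VU.
Qed.

Lemma spec_sec1 U : open U -> spec_sec U (fun x => 1).
Proof.
move=> oU p Up; exists U; split=> //; exists 1, 1 => q _.
have q1 : (1 : A) \notin pideal q by rewrite idealr1.
by exists q1; rewrite -frac1; apply: frac_eq => /=; ring.
Qed.

Lemma spec_secB U s t : open U -> spec_sec U s -> spec_sec U t ->
  spec_sec U (fun x => s x - t x).
Proof.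
move=> oU hs ht p Up; have [V [oV Vp VU [a [b h]]]] := hs p Up.
have [W [oW Wp WU [c [d k]]]] := ht p Up.
exists (V `&` W); split=> //; first exact: openI.
  by move=> q [/VU].
exists (a * d - c * b), (b * d) => q [Vq Wq].
have [bq eb] := h q Vq; have [dq ed] := k q Wq.
have bdq : b * d \notin pideal q.
  by rewrite prime_idealrM negb_or bq.
exists bdq; rewrite eb ed fracN fracD; apply: frac_eq => /=; ring.
Qed.

Lemma spec_secM U s t : open U -> spec_sec U s -> spec_sec U t ->
  spec_sec U (fun x => s x * t x).
Proof.
move=> oU hs ht p Up; have [V [oV Vp VU [a [b h]]]] := hs p Up.
have [W [oW Wp WU [c [d k]]]] := ht p Up.
exists (V `&` W); split=> //; first exact: openI.
  by move=> q [/VU].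
exists (a * c), (b * d) => q [Vq Wq].
have [bq eb] := h q Vq; have [dq ed] := k q Wq.
have bdq : b * d \notin pideal q.
  by rewrite prime_idealrM negb_or bq.
exists bdq; rewrite eb ed fracM; apply: frac_eq => /=; ring.
Qed.

Lemma open_basic (a : A) : open ([set q : S | a \notin pideal q]).
Proof.
exists [set a]; apply/seteqP; split=> q /=; first by exists a.
by move=> [_ ->].
Qed.

Lemma spec_germ_ex (p : S) (x : spec_stalk p) :
  exists U s, [/\ open U, U p, spec_sec U s & s p = x].
Proof.
elim/fracW: x => a b.
pose U := [set q : S | den b \notin pideal q].
pose s (q : S) : spec_stalk q :=
  if pselect (den b \notin pideal q) is left bq
  then frac a (Denom bq) else 0.
have oU : open U by exact: open_basic.
exists U, s; split=> //.
- exact: (denP b).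
- move=> q Uq; exists U; split=> //; exists a, (den b) => r Ur; exists Ur.
  rewrite /s; case: pselect => // bq.
  by apply: frac_eq.
- rewrite /s; case: pselect => [bp|]; last by case; exact: (denP b).
  by apply: frac_eq.
Qed.

Lemma spec_germ_eq U s t (p : S) : open U -> spec_sec U s -> spec_sec U t ->
  U p -> s p = t p ->
  exists V, [/\ open V, V p, V `<=` U & forall y, V y -> s y = t y].
Proof.
move=> oU hs ht Up; have [V [oV Vp VU [a [b h]]]] := hs p Up.
have [W [oW Wp WU [c [d k]]]] := ht p Up.
have [bp ->] := h p Vp; have [dp ->] := k p Wp => /fracP[u up /= e].
exists (V `&` W `&` [set q : S | u \notin pideal q]); split.
- by apply: openI; [exact: openI | exact: open_basic].
- by [].
- by move=> q [[/VU]].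
- move=> q [[Vq Wq] uq]; have [bq ->] := h q Vq; have [dq ->] := k q Wq.
  by apply/fracP; exists u.
Qed.

Definition spec_lrs : lrs :=
  Lrs spec_sec_ext spec_sec_res spec_sec_glue spec_sec1 spec_secB spec_secM
    spec_germ_ex spec_germ_eq
    (fun p : S => localization_local (pideal p)).

End Spec.

Section SpecMap.
Variables (A B : comNzRingType) (phi : {rmorphism A -> B}).

Definition spec_fun (q : spec B) : spec A :=
  SpecPoint (comap_idealr phi (pideal q)) (@comap_prime A B phi (pideal q)).

Lemma spec_fun_continuous : continuous spec_fun.
Proof.
apply/continuousP => _ [E ->]; exists (phi @` E).
apply/seteqP; split=> q.
  by move=> [a Ea ap]; exists (phi a) => //; exists a.
by move=> [_ [a Ea <-] ap]; exists a.
Qed.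

Definition spec_mor : mor (spec_lrs B) (spec_lrs A).
Proof.
refine (@Mor (spec_lrs B) (spec_lrs A) spec_fun
  (fun q => @loc_map A B phi (pideal q)) spec_fun_continuous _ _).
- move=> V t oV ht q Vq; have [W [oW Wq WV [a [b h]]]] := ht _ Vq.
  exists (spec_fun @^-1` W); split=> //.
  + by move/continuousP: spec_fun_continuous; apply.
  + by move=> r /WV.
  + exists (phi a), (phi b) => r Wr; have [br ->] := h _ Wr.
    exists br; apply: etrans (@loc_mapE A B phi (pideal r) a (Denom br)) _.
    exact: frac_eq.
- by move=> q; exact: loc_map_local.
Defined.

End SpecMap.

Record scheme := Scheme {
  scheme_lrs :> lrs;
  scheme_affine : forall x : scheme_lrs,
    exists (A : comNzRingType) (j : mor (spec_lrs A) scheme_lrs),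
      open_immersion j /\ exists y, j y = x }.

Lemma spec_affine (A : comNzRingType) (x : spec_lrs A) :
  exists (B : comNzRingType) (j : mor (spec_lrs B) (spec_lrs A)),
    open_immersion j /\ exists y, j y = x.
Proof.
exists A, (mor_id _); split; last by exists x.
split=> [y z //|U|y]; first by rewrite image_id.
by exists id.
Qed.

Definition Spec (A : comNzRingType) : scheme := Scheme (@spec_affine A).

Definition Spec_map (A B : comNzRingType) (phi : {rmorphism A -> B}) :
  mor (Spec B) (Spec A) := spec_mor phi.

Definition flat_mor (X Y : scheme) (f : mor X Y) : Prop :=
  forall x, flat_hom (mor_stalk f x).

Definition is_fibre_product (X Y S P : scheme) (f : mor X S) (g : mor Y S)
    (pX : mor P X) (pY : mor P Y) : Prop :=
  eq_mor (mor_comp f pX) (mor_comp g pY) /\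
  forall (T : scheme) (a : mor T X) (b : mor T Y),
    eq_mor (mor_comp f a) (mor_comp g b) ->
    exists h : mor T P,
      [/\ eq_mor (mor_comp pX h) a, eq_mor (mor_comp pY h) b &
          forall h' : mor T P, eq_mor (mor_comp pX h') a ->
            eq_mor (mor_comp pY h') b -> eq_mor h' h].

Definition irreducible_closed (X : topologicalType) (Z : set X) : Prop :=
  [/\ closed Z, Z !=set0 &
      forall F G : set X, closed F -> closed G ->
        Z `<=` F `|` G -> Z `<=` F \/ Z `<=` G].

Definition irreducible_chain (X : topologicalType) (n : nat) : Prop :=
  exists Z : nat -> set X,
    (forall i, (i <= n)%N -> irreducible_closed (Z i)) /\
    (forall i, (i < n)%N -> Z i `<` Z i.+1).

Definition has_dimension (X : topologicalType) (n : nat) : Prop :=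
  irreducible_chain X n /\ ~ irreducible_chain X n.+1.

Definition locally_noetherian (X : scheme) : Prop :=
  forall x : X, exists (A : comNzRingType) (j : mor (Spec A) X),
    [/\ noetherian A, open_immersion j & exists y, j y = x].

Definition gorenstein_scheme (X : scheme) : Prop :=
  locally_noetherian X /\ forall x, gorenstein_local_ring (stalk X x).

Definition liftable (R : comNzRingType) (k : fieldType)
    (pi : {rmorphism R -> k}) (X : scheme) (f : mor X (Spec k)) : Prop :=
  exists (Xt : scheme) (g : mor Xt (Spec R)) (i : mor X Xt),
    [/\ flat_mor g, closed_immersion i &
        exists (P : scheme) (pX : mor P Xt) (pk : mor P (Spec k)) (u : mor X P),
          [/\ is_fibre_product g (Spec_map pi) pX pk,
              eq_mor (mor_comp pX u) i, eq_mor (mor_comp pk u) f &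
              is_iso u]].

(* Main.v *)
Require Import Defs.
From HB Require Import structures.
From mathcomp Require Import all_boot all_order all_algebra.
From mathcomp Require Import generic_quotient ring_quotient.
From mathcomp Require Import boolp classical_sets topology_structure.
From mathcomp Require Import ring zify.
From mathcomp Require mpoly.

Import Defs.

(** The obstruction to lifting is a divided Frobenius: in the fibre over k
the p-th power map is additive, while in a lift the cross terms of a p-th power
survive, multiplied by p.

Let m be the maximal ideal of R.  As R is noetherian there is an ideal I with
p outside I, p m inside I and m^N inside I for large N ([separating_ideal]).
Put W(a, b) = ((a + b)^p - a^p - b^p) / p, r = p^n and q = p^(n+1) >= N.
Suppose that A is flat over R and that A/mA contains elements x_ij, with i < 3
and j < q, such that x_ij^q = 0 and y_0 + y_1 + y_2 = 0 for y_i the product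
over j of the x_ij.  Lift x_ij to X_ij in A and let Y_i be the product of the
X_ij.  Each X_ij^q lies in mA, so Y_i^q lies in (mA)^q, hence in IA; taking q
factors makes this independent of how p ramifies in R.  Since Y_0 + Y_1 + Y_2
lies in mA, expanding (Y_0 + Y_1)^q by

  (a + b)^q = a^q + b^q + p W(a^r, b^r)  modulo p^2   ([exprD_prime_power])

once as it stands and once as (epsilon - Y_2)^q with epsilon in mA shows that
p W(Y_0^r, Y_1^r) lies in IA.  Multiplication by p embeds R/m in R/I, and by
flatness it embeds A/mA in A/IA ([flat_divide]); therefore W(y_0^r, y_1^r) = 0
in A/mA ([lift_relation]).

So any artinian Gorenstein local k-algebra B containing such x_ij, but with
W(y_0^r, y_1^r) <> 0, is not the fibre of a flat A.  One is obtained by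
Macaulay's inverse systems ([macaulay], [gorenstein_algebra]): B is the quotient
of k[x_ij] by the largest ideal in the kernel of a linear form.  The form
vanishes on the monomials that are not of the shape y_0^a y_1^b y_2^c, and takes
on these the coefficient of u^r v^(q-r) in u^a v^b (-u-v)^c.  It kills the
multiples of y_0 + y_1 + y_2 by construction, and those of x_ij^q because
(u + v)^q = u^q + v^q.  It induces a nondegenerate form on B, which identifies
B with its k-dual, so that B is self-injective ([frobenius_injective]).

On the geometric side, a lift of Spec B yields a flat local homomorphism from R
to the local ring A of the lift at the image of the point of Spec B.  Testing
the fibre product against the spectrum of A/mA shows that the kernel of
A -> B is exactly mA ([lift_stalk]). *)

Set Implicit Arguments.
Unset Strict Implicit.
Unset Printing Implicit Defensive.

Import GRing.Theory.

Local Open Scope ring_scope.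

(** * Ideals and the ascending chain condition *)

Section Ideals.
Variable A : comNzRingType.
Implicit Types (J : A -> Prop) (a u v x : A).

(** Unlike the members of [idealr A], these may contain 1, so that sums,
transporters and unions of chains are formed without side conditions. *)
Definition is_ideal J := J 0 /\ forall a u v, J u -> J v -> J (a * u + v).

Lemma ideal_add J u v : is_ideal J -> J u -> J v -> J (u + v).
Proof. by move=> [_ h] Ju Jv; rewrite -[u]mul1r; apply: h. Qed.

Lemma ideal_mull J a u : is_ideal J -> J u -> J (a * u).
Proof. by move=> [h0 h] Ju; rewrite -[_ * _]addr0; apply: h. Qed.

Lemma ideal_mulr J a u : is_ideal J -> J u -> J (u * a).
Proof. by rewrite mulrC; apply: ideal_mull. Qed.

Lemma ideal_opp J u : is_ideal J -> J u -> J (- u).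
Proof. by rewrite -mulN1r; apply: ideal_mull. Qed.

Lemma ideal_sub J u v : is_ideal J -> J u -> J v -> J (u - v).
Proof. by move=> hJ Ju Jv; apply: ideal_add => //; apply: ideal_opp. Qed.

Lemma ideal_sum J (I : Type) (s : seq I) (P : pred I) (F : I -> A) :
  is_ideal J -> (forall i, P i -> J (F i)) -> J (\sum_(i <- s | P i) F i).
Proof.
move=> hJ hF; elim/big_ind: _ => //; first exact: hJ.1.
by move=> *; apply: ideal_add.
Qed.

Section Pack.
Variables (J : A -> Prop) (J_ideal : is_ideal J) (J_proper : ~ J 1).

Definition ideal_pred : pred A := fun x => `[< J x >].

Lemma ideal_predP : idealr_closed ideal_pred.
Proof.
have E x : (x \in ideal_pred) = `[< J x >] by [].
split; rewrite ?E.
- by apply/asboolP; case: J_ideal.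
- by apply/asboolP.
- move=> a u v; rewrite !E => /asboolP Ju /asboolP Jv; apply/asboolP.
  by case: J_ideal => _; apply.
Qed.

Definition pack_ideal : idealr A :=
  HB.pack_for (idealr A) ideal_pred (isIdealr.Build A ideal_pred ideal_predP).

Lemma pack_idealE x : (x \in pack_ideal) <-> J x.
Proof. by split=> [/asboolP|?]; [|apply/asboolP]. Qed.

End Pack.

Definition genideal n (g : 'I_n -> A) : A -> Prop :=
  fun x => exists c : 'I_n -> A, x = \sum_i c i * g i.

Lemma idealr_is_ideal (I : idealr A) : is_ideal (fun x => x \in I).
Proof.
split=> [|a u v Iu Iv]; first exact: idealr0.
by apply: rpredD => //; exact: idealMr.
Qed.

Lemma genideal_ideal n (g : 'I_n -> A) : is_ideal (genideal g).
Proof.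
split; first by exists (fun=> 0); rewrite big1 // => i _; rewrite mul0r.
move=> a u v [c ->] [d ->]; exists (fun i => a * c i + d i).
rewrite mulr_sumr -big_split /=; apply: eq_bigr => i _.
by rewrite mulrDl mulrA.
Qed.

Lemma genideal_gen n (g : 'I_n -> A) i : genideal g (g i).
Proof.
exists (fun j => (j == i)%:R); rewrite (bigD1 i) //= eqxx mul1r big1 ?addr0 //.
by move=> j /negPf ->; rewrite mul0r.
Qed.

Lemma genideal_sub n (g : 'I_n -> A) J :
  is_ideal J -> (forall i, J (g i)) -> forall x, genideal g x -> J x.
Proof.
by move=> hJ hg x [c ->]; apply: ideal_sum => // i _; apply: ideal_mull.
Qed.

Lemma noetherian_fg J : noetherian A -> is_ideal J ->
  exists n (g : 'I_n -> A), forall x, J x <-> genideal g x.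
Proof.
move=> hA hJ; case: (pselect (J 1)) => [J1|nJ1].
  exists 1%N, (fun=> 1) => x; split=> _.
    by exists (fun=> x); rewrite big_ord1 mulr1.
  by rewrite -[x]mulr1; apply: ideal_mull.
have [s hs] := hA (pack_ideal hJ nJ1).
exists (size s), (fun i => s`_i) => x.
split=> [/(pack_idealE hJ nJ1)/hs[c ->]|[c ->]].
  by exists (fun i => c i).
apply/(pack_idealE hJ nJ1)/hs; exists (fun i => oapp c 0 (insub i)).
by apply: eq_bigr => i _; rewrite valK.
Qed.

(** The union of the chain is an ideal, and its finitely many generators all
occur at one stage. *)
Lemma noetherian_chain (F : nat -> A -> Prop) : noetherian A ->
  (forall n, is_ideal (F n)) -> (forall n x, F n x -> F n.+1 x) ->
  exists n, forall m x, F m x -> F n x.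
Proof.
move=> hA hF hS.
have mono n m x : (n <= m)%N -> F n x -> F m x.
  move=> /subnKC <-; elim: (m - n)%N => [|d IH]; rewrite ?addn0 // addnS.
  by move=> /IH/hS.
have hU : is_ideal (fun x => exists n, F n x).
  split; first by exists 0%N; case: (hF 0%N).
  move=> a u v [n Fu] [m Fv]; exists (maxn n m).
  case: (hF (maxn n m)) => _; apply.
    by apply: mono Fu; exact: leq_maxl.
  by apply: mono Fv; exact: leq_maxr.
have [d [g hg]] := noetherian_fg hA hU.
have /choice[N hN] : forall i, exists n, F n (g i).
  by move=> i; apply/hg; exact: genideal_gen.
exists (\max_i N i) => m x Fx; have /hg : exists m, F m x by exists m.
apply: genideal_sub => // i; apply: mono (hN i).
exact: (leq_bigmax_cond (F := N)).
Qed.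

(** Were there no maximal member above J0, choosing strictly larger members
over and over would build a chain that contradicts [noetherian_chain]. *)
Lemma noetherian_max (C : (A -> Prop) -> Prop) J0 : noetherian A ->
  (forall J, C J -> is_ideal J) -> C J0 ->
  exists2 J, C J & (forall x, J0 x -> J x) /\
    forall J', C J' -> (forall x, J x -> J' x) -> forall x, J' x -> J x.
Proof.
move=> hA hC C0; apply: contrapT => hn.
pose D J := C J /\ forall x, J0 x -> J x.
have step (J : {J | D J}) : exists J' : {J | D J},
    (forall x, sval J x -> sval J' x) /\ exists2 x, sval J' x & ~ sval J x.
  case: J => J [CJ J0J] /=; apply: contrapT => hn'; apply: hn; exists J => //.
  split=> // J' CJ' JJ' x J'x; apply: contrapT => nJx; apply: hn'.
  have DJ' : D J' by split=> // y /J0J/JJ'.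
  by exists (exist _ J' DJ'); split=> //; exists x.
have [nxt hnxt] := choice step.
have D0 : D J0 by [].
pose F n := sval (iter n nxt (exist _ J0 D0)).
have [||n hF] := @noetherian_chain F hA.
- by move=> n; apply: hC; exact: (svalP (iter n nxt _)).1.
- by move=> n x; apply: (hnxt _).1.
have [x Fx nFx] := (hnxt (iter n nxt (exist _ J0 D0))).2.
by apply: nFx; apply: (hF n.+1).
Qed.

End Ideals.

Lemma rmorph_ker_ideal (A B : comNzRingType) (phi : {rmorphism A -> B}) :
  is_ideal (fun x => phi x = 0).
Proof.
split; first by rewrite rmorph0.
by move=> a u v hu hv; rewrite rmorphD rmorphM hu hv mulr0 addr0.
Qed.

(** * An ideal of a local ring just missing a given element *)

(** The kernel of pi is maximal, hence is the maximal ideal; a nonunit lies in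
some maximal ideal, hence in the kernel. *)
Lemma local_unit (R : comNzRingType) (k : fieldType) (pi : {rmorphism R -> k}) :
  noetherian R -> local_ring R -> (forall y, exists x, pi x = y) ->
  forall x, pi x != 0 -> is_unit x.
Proof.
move=> hR [m mm muniq] hpi x pix; apply: contrapT => nux.
have max_in J : (forall K, is_ideal K -> (forall y, J y -> K y) -> ~ K 1 ->
    forall y, K y -> J y) -> is_ideal J -> ~ J 1 -> forall y, J y <-> y \in m.
  move=> Jmax hJ J1 y; rewrite -(muniq (pack_ideal hJ J1)).
    by rewrite pack_idealE.
  move=> K JK z zK; apply/pack_idealE; apply: (Jmax (fun t => t \in K)) => //.
  - exact: idealr_is_ideal.
  - by move=> t Jt; apply: JK; apply/pack_idealE.
  - by rewrite idealr1.
pose K y := pi y = 0.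
have hK : is_ideal K by exact: rmorph_ker_ideal.
have K1 : ~ K 1 by rewrite /K rmorph1; apply/eqP; rewrite oner_eq0.
have Km y : K y <-> y \in m.
  apply: max_in => // L hL KL L1 z Lz; apply: contrapT => /eqP piz; apply: L1.
  have [w hw] := hpi (pi z)^-1.
  have -> : 1 = w * z + (1 - w * z) by ring.
  apply: (ideal_add hL); first exact: ideal_mull.
  by apply: KL; rewrite /K rmorphB rmorphM rmorph1 hw mulVf ?subrr.
pose Jx y := exists r, y = r * x.
have hJx : is_ideal Jx.
  split; first by exists 0; rewrite mul0r.
  by move=> a _ _ [r ->] [s ->]; exists (a * r + s); ring.
have Jx1 : ~ Jx 1 by move=> [r h]; apply: nux; exists r; rewrite mulrC.
have [||J [hJ J1] [JxJ Jmax]] :=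
    @noetherian_max R (fun J => is_ideal J /\ ~ J 1) Jx hR => //.
  by move=> J [].
have /Km : x \in m.
  apply/(max_in J) => //; last by apply: JxJ; exists 1; rewrite mul1r.
  by move=> L hL JL L1; apply: Jmax.
by rewrite /K; apply/eqP.
Qed.

(** For I maximal among the ideals that avoid t, every ideal strictly containing
I contains t.  By Nakayama t is not in I + t m, so t m lies in I.  If x is in m
and no power of x is in I, let n be a stage at which the transporters (I : x^n)
become stationary.  Then t = i + r x^(n+1) for some i in I, and x t in I gives
x^(n+2) r in I, whence x^n r in I and t in I.  The conclusion about powers of
generators of m says that m is nilpotent modulo I, which is how Krull's
intersection theorem enters. *)
Lemma separating_ideal (R : comNzRingType) (k : fieldType) (pi : {rmorphism R -> k}) t :
  noetherian R -> local_ring R -> (forall y, exists x, pi x = y) ->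
  pi t = 0 -> t != 0 ->
  exists I : R -> Prop, [/\ is_ideal I, ~ I 1,
    forall x, I (t * x) <-> pi x = 0 &
    exists e s (a : 'I_s -> R), (forall i, I (a i ^+ e)) /\
      forall x, pi x = 0 <-> genideal a x].
Proof.
move=> hR hl hpi pit t0; have unitP := local_unit hR hl hpi.
have [||I [hI It] [_ Imax]] :=
    @noetherian_max R (fun J => is_ideal J /\ ~ J t) (fun x => x = 0) hR => //.
- by move=> J [].
- split=> [|/eqP]; last by rewrite (negPf t0).
  by split=> // a u v -> ->; rewrite mulr0 addr0.
(* maximality of I: an element outside I generates t modulo I *)
have addI y : ~ I y -> exists i r, I i /\ t = i + r * y.
  move=> Iy; apply: contrapT => hn; apply: Iy.
  apply: (Imax (fun z => exists i r, I i /\ z = i + r * y)).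
  - split=> //; split; first by exists 0, 0; split; [case: hI|ring].
    move=> a _ _ [i [r [Ii ->]]] [j [s [Ij ->]]].
    by exists (a * i + j), (a * r + s); split; [case: hI => _; apply|ring].
  - by move=> x Ix; exists x, 0; split=> //; ring.
  - by exists 0, 1; split; [case: hI|ring].
have mI x : pi x = 0 -> I (t * x).
  move=> pix; apply: contrapT => /addI[i [r [Ii e]]]; apply: It.
  have [v hv] : is_unit (1 - r * x).
    by apply: unitP; rewrite rmorphB rmorphM pix mulr0 subr0 rmorph1 oner_eq0.
  have -> : t = v * i.
    rewrite (_ : i = t * (1 - r * x)); last by rewrite mulrBr mulr1 {1}e; ring.
    by rewrite mulrC -mulrA hv mulr1.
  exact: ideal_mull.
exists I; split=> //.
- by move=> I1; apply: It; rewrite -[t]mulr1; apply: ideal_mull.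
- move=> x; split; last exact: mI.
  move=> Itx; apply: contrapT => /eqP/unitP[v hv]; apply: It.
  by rewrite -[t]mulr1 -hv mulrA; apply: ideal_mulr.
have [s [a ha]] := noetherian_fg hR (rmorph_ker_ideal pi).
have /choice[E hE] : forall i, exists e, I (a i ^+ e).
  move=> i; set x := a i.
  have pix : pi x = 0 by apply/ha; exact: genideal_gen.
  have [||n hn] := @noetherian_chain R (fun n y => I (x ^+ n * y)) hR.
  - move=> n; split; first by rewrite mulr0; case: hI.
    move=> b u v Iu Iv.
    rewrite (_ : _ * _ = b * (x ^+ n * u) + x ^+ n * v); last by ring.
    by case: hI => _; apply.
  - by move=> n y Iy; rewrite exprS -mulrA; apply: ideal_mull.
  exists n.+1; apply: contrapT => /addI[j [r [Ij e]]]; apply: It.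
  have Ir : I (x ^+ n * r).
    apply: (hn n.+2); rewrite (_ : _ * _ = t * x - x * j); last by rewrite e !exprS; ring.
    by apply: ideal_sub => //; [exact: mI | exact: ideal_mull].
  rewrite e; apply: ideal_add => //.
  rewrite (_ : _ * _ = x * (x ^+ n * r)); last by rewrite exprS; ring.
  exact: ideal_mull.
exists (\max_i E i), s, a; split=> // i.
rewrite -(subnK (leq_bigmax_cond (F := E) i isT)) exprD.
exact: ideal_mull.
Qed.

(** * Extension of ideals and flatness *)

(** The extension JA of an ideal J of S along gamma : S -> A. *)
Definition extend (S A : comNzRingType) (gamma : {rmorphism S -> A})
  (J : S -> Prop) : A -> Prop :=
  fun x => exists n (c : 'I_n -> S) (d : 'I_n -> A),
    (forall i, J (c i)) /\ x = \sum_i gamma (c i) * d i.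

Section Extend.
Variables (S A : comNzRingType) (gamma : {rmorphism S -> A}).

Lemma extend_ideal J : is_ideal (extend gamma J).
Proof.
split; first by exists 0%N, (fun=> 0), (fun=> 0); split=> [[]|]; rewrite ?big_ord0.
move=> a _ _ [n [c [d [hc ->]]]] [m [c' [d' [hc' ->]]]].
exists (n + m)%N, (fun i => match split i with inl j => c j | inr j => c' j end),
  (fun i => match split i with inl j => a * d j | inr j => d' j end).
split; first by move=> i; case: (split i).
rewrite big_split_ord mulr_sumr; congr (_ + _); apply: eq_bigr => i _.
  by rewrite (unsplitK (inl i)) mulrCA.
by rewrite (unsplitK (inr i)).
Qed.

Lemma extend_gen (J : S -> Prop) x : J x -> extend gamma J (gamma x).
Proof.
by move=> Jx; exists 1%N, (fun=> x), (fun=> 1); rewrite big_ord1 mulr1.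
Qed.

Lemma extend_sub J (K : A -> Prop) : is_ideal K ->
  (forall x, J x -> K (gamma x)) -> forall x, extend gamma J x -> K x.
Proof.
move=> hK JK x [n [c [d [hc ->]]]].
by apply: ideal_sum => // i _; apply: ideal_mulr => //; apply: JK.
Qed.

End Extend.

(** For an ideal J of S, the tensor product of S/J and A over S is A/JA.  The
quotients enter through arbitrary surjections [alpha : S -> S/J] and
[beta : A -> A/JA] with the right kernels. *)
Section TensorQuotient.
Variables (S A S1 A1 : comNzRingType) (gamma : {rmorphism S -> A}).
Variables (alpha : {rmorphism S -> S1}) (beta : {rmorphism A -> A1}).
Hypothesis alpha_surj : forall y, exists x, alpha x = y.
Hypothesis beta_surj : forall y, exists x, beta x = y.
Hypothesis beta_ker : forall x,
  beta x = 0 <-> extend gamma (fun s => alpha s = 0) x.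

Let sa := projT1 (choice alpha_surj).
Let saK y : alpha (sa y) = y. Proof. exact: (projT2 (choice alpha_surj)). Qed.
Let sb := projT1 (choice beta_surj).
Let sbK y : beta (sb y) = y. Proof. exact: (projT2 (choice beta_surj)). Qed.

Let bg0 s : alpha s = 0 -> beta (gamma s) = 0.
Proof. by move=> h; apply/beta_ker/extend_gen. Qed.

Let bgE s s' : alpha s = alpha s' -> beta (gamma s) = beta (gamma s').
Proof.
move=> h; apply/eqP; rewrite -subr_eq0 -!rmorphB; apply/eqP/bg0.
by rewrite rmorphB h subrr.
Qed.

Definition quotient_module : lmodType S := restrict_scalars alpha.
Definition base_module : lmodType S := restrict_scalars gamma.
Definition quotient_extension : lmodType S := restrict_scalars (beta \o gamma).

Definition quotient_tensor_fun (x : quotient_module) (a : base_module) :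
  quotient_extension := beta (gamma (sa x) * (a : A)).

Lemma quotient_tensor_bilinear :
  bilinear_for *:%R *:%R quotient_tensor_fun.
Proof.
split=> [a c x y|x c a b]; rewrite /quotient_tensor_fun /=.
  rewrite /GRing.scale /= /restrict_scale /= -rmorphM -rmorphD mulrA -rmorphM -mulrDl -rmorphD.
  rewrite !rmorphM; congr (_ * _); apply: bgE.
  by rewrite rmorphD rmorphM !saK.
rewrite /GRing.scale /= /restrict_scale /= -rmorphM -rmorphD. apply: (congr1 beta).
by rewrite mulrDr; congr (_ + _); rewrite mulrCA.
Qed.

Definition quotient_tensor :
  {bilinear quotient_module -> base_module -> quotient_extension} :=
  HB.pack_for {bilinear quotient_module -> base_module -> quotient_extension}
    quotient_tensor_fun
    (bilinear_isBilinear.Build S quotient_module base_module quotient_extension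
       *:%R *:%R quotient_tensor_fun quotient_tensor_bilinear).

Lemma quotient_tensorE s (a : A) :
  quotient_tensor (alpha s : quotient_module) (a : base_module) = beta (gamma s * a).
Proof.
by rewrite /= /quotient_tensor_fun !rmorphM (bgE (saK (alpha s))).
Qed.

(** A bilinear map b is determined by b(1, -), which kills JA because
b(1, gamma(c) d) = b(c 1, d) = 0 for c in J. *)
Lemma quotient_tensorP : is_tensor_product quotient_tensor.
Proof.
move=> Z b.
pose b1 : {linear base_module -> Z} := b (1 : S1).
have b1E s (a : base_module) : b (alpha s : quotient_module) a = s *: b1 a.
  have -> : (alpha s : quotient_module) = s *: (1 : quotient_module).
    by rewrite /GRing.scale /= /restrict_scale mulr1.
  by rewrite linearZl_LR.
have b1g s (a : A) : b1 (gamma s * a : A) = s *: b1 (a : base_module).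
  by rewrite -linearZ.
have b10 (x : A) : beta x = 0 -> b1 (x : base_module) = 0.
  move=> /beta_ker[n [c [d [hc ->]]]].
  rewrite (linear_sum b1) big1 // => i _.
  by rewrite b1g -b1E hc linear0l.
have b1beta (x y : A) : beta x = beta y -> b1 (x : base_module) = b1 (y : base_module).
  move=> h; apply/eqP; rewrite -subr_eq0 -linearB; apply/eqP/b10.
  by rewrite rmorphB h subrr.
pose h (y : quotient_extension) : Z := b1 (sb y : base_module).
have h_lin : linear h.
  move=> c x y; rewrite /h -b1g -linearD; apply: b1beta.
  by rewrite rmorphD rmorphM !sbK.
pose hl : {linear quotient_extension -> Z} :=
  HB.pack_for {linear quotient_extension -> Z} h
   (GRing.isLinear.Build S quotient_extension Z _ h h_lin).
exists hl; split=> [x a|h' hh' y].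
  rewrite -(saK x) quotient_tensorE /= /h b1E -b1g; apply: b1beta.
  by rewrite sbK.
rewrite -(sbK y) -[sb y]mul1r -[1](rmorph1 gamma) -quotient_tensorE hh' b1E.
by rewrite quotient_tensorE /= /h -b1g; apply: b1beta; rewrite sbK.
Qed.

End TensorQuotient.

Lemma quotient_ring (A : comNzRingType) (J : A -> Prop) : is_ideal J -> ~ J 1 ->
  exists (A1 : comNzRingType) (beta : {rmorphism A -> A1}),
    (forall y, exists x, beta x = y) /\ forall x, beta x = 0 <-> J x.
Proof.
move=> hJ J1; pose I := pack_ideal hJ J1.
exists {ideal_quot I}, (\pi_{ideal_quot I})%qT; split=> [y|x].
  by exists (repr (y : {ideal_quot I}))%qT; exact: (reprK (y : {ideal_quot I})).
rewrite -(pack_idealE hJ J1) -[x in x \in _]subr0 -/I Quotient.idealrBE.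
have pi0 := rmorph0 (\pi_{ideal_quot I})%qT.
by split=> [e|/eqP e]; [apply/eqP|]; apply: etrans e _.
Qed.

(** Multiplication by t is an injection S/J -> S/I; flatness keeps it injective
after tensoring with A, where it becomes multiplication by gamma(t) from A/JA to
A/IA. *)
Lemma flat_divide (S A : comNzRingType) (gamma : {rmorphism S -> A})
    (I J : S -> Prop) (t : S) (a : A) :
  flat_hom gamma -> is_ideal I -> is_ideal J ->
  (forall x, I (t * x) <-> J x) -> ~ extend gamma J 1 ->
  extend gamma I (gamma t * a) -> extend gamma J a.
Proof.
move=> flat hI hJ IJ properJ ta.
have I_J x : I x -> J x by move=> Ix; apply/IJ; exact: ideal_mull.
have properI : ~ extend gamma I 1.
  by move=> [n [c [d [hc e]]]]; apply: properJ; exists n, c, d; split=> // i; apply: I_J.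
have [|S1 [al [al_surj al_ker]]] := quotient_ring hJ.
  by move=> J1; apply: properJ; rewrite -(rmorph1 gamma); apply: extend_gen.
have [|S2 [al' [al'_surj al'_ker]]] := quotient_ring hI.
  by move=> I1; apply: properI; rewrite -(rmorph1 gamma); apply: extend_gen.
have [A1 [be [be_surj be_ker]]] := quotient_ring (extend_ideal gamma J) properJ.
have [A2 [be' [be'_surj be'_ker]]] := quotient_ring (extend_ideal gamma I) properI.
have be_kerP x : be x = 0 <-> extend gamma (fun s => al s = 0) x.
  rewrite be_ker; split=> -[n [c [d [hc e]]]]; exists n, c, d; split=> // i.
    exact/al_ker.
  exact/al_ker.
have be'_kerP x : be' x = 0 <-> extend gamma (fun s => al' s = 0) x.
  rewrite be'_ker; split=> -[n [c [d [hc e]]]]; exists n, c, d; split=> // i.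
    exact/al'_ker.
  exact/al'_ker.
have [sa saK] := choice al_surj.
have [sb sbK] := choice be_surj.
pose u0 (x : quotient_module al) : quotient_module al' := al' (t * sa x).
have al'E x y : al x = al y -> al' (t * x) = al' (t * y).
  move=> h; apply/eqP; rewrite -subr_eq0 -rmorphB -mulrBr; apply/eqP/al'_ker/IJ/al_ker.
  by rewrite rmorphB h subrr.
have be'E x y : be x = be y -> be' (gamma t * x) = be' (gamma t * y).
  move=> h; apply/eqP; rewrite -subr_eq0 -rmorphB -mulrBr; apply/eqP/be'_ker.
  have /be_ker[n [c [d [hc ->]]]] : be (x - y) = 0 by rewrite rmorphB h subrr.
  exists n, (fun i => t * c i), d; split=> [i|]; first exact/IJ.
  by rewrite mulr_sumr; apply: eq_bigr => i _; rewrite rmorphM mulrA.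
have u_lin : linear u0.
  move=> c x y; rewrite /u0 /GRing.scale /= /restrict_scale -rmorphM -rmorphD.
  rewrite mulrCA -mulrDr; apply: al'E.
  by rewrite rmorphD rmorphM !saK.
pose u : {linear quotient_module al -> quotient_module al'} :=
  HB.pack_for {linear quotient_module al -> quotient_module al'} u0
   (GRing.isLinear.Build S (quotient_module al) (quotient_module al') _ u0 u_lin).
pose h0 (x : quotient_extension gamma be) : quotient_extension gamma be' :=
  be' (gamma t * sb x).
have h_lin : linear h0.
  move=> c x y; rewrite /h0 /GRing.scale /= /restrict_scale /= -rmorphM -rmorphD.
  rewrite mulrCA -mulrDr; apply: be'E.
  by rewrite rmorphD rmorphM !sbK.
pose h : {linear quotient_extension gamma be -> quotient_extension gamma be'} :=
  HB.pack_for {linear quotient_extension gamma be -> quotient_extension gamma be'} h0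
   (GRing.isLinear.Build S (quotient_extension gamma be)
     (quotient_extension gamma be') _ h0 h_lin).
have u_inj : injective u.
  move=> x y /= uxy; rewrite -[x]saK -[y]saK; apply/eqP.
  rewrite -subr_eq0 -rmorphB; apply/eqP/al_ker/IJ/al'_ker.
  by rewrite mulrBr rmorphB; apply/eqP; rewrite subr_eq0; apply/eqP.
have := flat _ _ _ _ u _ _ h
  (quotient_tensorP al_surj be_surj be_kerP)
  (quotient_tensorP al'_surj be'_surj be'_kerP) _ u_inj.
have hE (x : quotient_module al) (y : base_module gamma) :
    h (quotient_tensor al_surj be_kerP x y)
    = quotient_tensor al'_surj be'_kerP (u x) y.
  have tE : quotient_tensor al_surj be_kerP x y = be (gamma (sa x) * y).
    by rewrite -{1}(saK x) quotient_tensorE.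
  have t'E : quotient_tensor al'_surj be'_kerP (u x) y = be' (gamma (t * sa x) * y).
    exact: quotient_tensorE.
  rewrite t'E tE /= /h0 [gamma (_ * _)]rmorphM -mulrA; apply: be'E.
  by rewrite sbK.
move=> /(_ hE) h_inj; apply/be_ker; apply: h_inj.
rewrite /= /h0; apply: (etrans (y := be' (gamma t * a))).
  by apply: be'E; rewrite sbK.
apply: (etrans (y := 0)); first exact/be'_ker.
by rewrite (be'E _ 0) ?mulr0 ?rmorph0 // sbK rmorph0.
Qed.

(** Expanding a product of N > s e combinations of the s generators, every term
contains some generator at least e times, by the pigeonhole principle. *)
Lemma extend_prod (R A : comNzRingType) (rho : {rmorphism R -> A})
    (I J : R -> Prop) s (a : 'I_s -> R) e N (f : 'I_N -> A) :
  is_ideal I -> (forall i, I (a i ^+ e)) -> (forall x, J x -> genideal a x) ->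
  (s * e < N)%N -> (forall j, extend rho J (f j)) ->
  extend rho I (\prod_j f j).
Proof.
move=> hI ae Ja sN hf.
have IA := extend_ideal rho I.
have /choice[c hc] : forall j, exists c : 'I_s -> A, f j = \sum_i c i * rho (a i).
  move=> j; have := hf j; apply: (@extend_sub _ _ rho J (genideal (rho \o a))).
    exact: genideal_ideal.
  move=> x /Ja[c ->]; rewrite rmorph_sum; exists (rho \o c).
  by apply: eq_bigr => i _; rewrite rmorphM.
under eq_bigr do rewrite hc.
rewrite bigA_distr_bigA /=; apply: ideal_sum => // phi _.
have [i hi] : exists i, (e <= #|[pred j | phi j == i]|)%N.
  apply: contrapT => hn; have : (N <= s * e)%N; last by rewrite leqNgt sN.
  rewrite -{1}[N]card_ord -sum1_card (partition_big phi xpredT) //=.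
  rewrite -[s in (_ <= s * _)%N]card_ord -sum_nat_const; apply: leq_sum => i _.
  rewrite sum1_card leqNgt; apply/negP => lt; apply: hn; exists i; exact: ltnW.
rewrite (bigID (fun j => phi j == i)) /=; apply: ideal_mulr => //.
rewrite big_split /=; apply: ideal_mull => //.
rewrite (eq_bigr (fun=> rho (a i))) => [|j /eqP-> //].
rewrite prodr_const -(subnK hi) exprD; apply: ideal_mull => //.
by rewrite -rmorphXn; apply: extend_gen.
Qed.

(** Form of [flat_divide] for ideals of a ring R identified with S by an
isomorphism.  It serves for R local and S its localization at the maximal
ideal. *)
Lemma flat_divide_iso (R S A : comNzRingType) (iota : {rmorphism R -> S})
    (gamma : {rmorphism S -> A}) (I J : R -> Prop) (t : R) (a : A) :
  flat_hom gamma -> bijective iota -> is_ideal I -> is_ideal J ->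
  (forall x, I (t * x) <-> J x) -> ~ extend (gamma \o iota) J 1 ->
  extend (gamma \o iota) I (gamma (iota t) * a) -> extend (gamma \o iota) J a.
Proof.
move=> flat [inv iotaK invK] hI hJ IJ.
have invM x y : inv (x * y) = inv x * inv y.
  by apply: (can_inj iotaK); rewrite rmorphM !invK.
have invD x y : inv (x + y) = inv x + inv y.
  by apply: (can_inj iotaK); rewrite rmorphD !invK.
have inv0 : inv 0 = 0 by apply: (can_inj iotaK); rewrite invK rmorph0.
have invI (K : R -> Prop) : is_ideal K -> is_ideal (K \o inv).
  move=> hK; split; first by rewrite /= inv0; case: hK.
  by move=> b u v Ku Kv; rewrite /= invD invM; case: hK => _; apply.
have ext (K : R -> Prop) x : extend (gamma \o iota) K x <-> extend gamma (K \o inv) x.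
  split=> -[n [c [d [hc ->]]]].
    by exists n, (iota \o c), d; split=> // j; rewrite /= iotaK.
  by exists n, (inv \o c), d; split=> //; apply: eq_bigr => j _; rewrite /= invK.
rewrite !ext => proper ta.
apply: (flat_divide flat (invI I hI) (invI J hJ) _ proper ta) => x.
by rewrite /= invM iotaK.
Qed.

(** * Frobenius algebras are Gorenstein *)

(** The k-structure is carried by [kappa], so that it moves along ring
isomorphisms; nondegeneracy says that the kernel of Lam contains no nonzero
ideal, which for B local forces the socle to be simple. *)
Record frobenius_algebra (k : fieldType) (B : comNzRingType)
    (kappa : {rmorphism k -> B}) (Lam : B -> k) : Prop := FrobeniusAlgebra {
  frob_span : exists n (e : 'I_n -> B), forall x,
    exists c : 'I_n -> k, x = \sum_i kappa (c i) * e i;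
  frob_linear : forall a x y, Lam (kappa a * x + y) = a * Lam x + Lam y;
  frob_nondeg : forall x, (forall y, Lam (x * y) = 0) -> x = 0 }.

Section FiniteAlgebra.
Variables (k : fieldType) (C : comNzRingType) (kappa : {rmorphism k -> C}).
Variables (n : nat) (e : 'I_n -> C).
Hypothesis e_span : forall x, exists c : 'I_n -> k, x = \sum_i kappa (c i) * e i.

Let comb (v : 'rV[k]_n) : C := \sum_i kappa (v 0 i) * e i.

Let combP x : exists v, x = comb v.
Proof.
have [c ->] := e_span x; exists (\row_i c i).
by apply: eq_bigr => i _; rewrite mxE.
Qed.

Let comb_mul m (u : 'rV_m) (M : 'M_(m, n)) :
  comb (u *m M) = \sum_i kappa (u 0 i) * comb (row i M).
Proof.
rewrite /comb; under eq_bigr => j _.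
  rewrite mxE rmorph_sum mulr_suml.
  under eq_bigr => i _ do rewrite rmorphM -mulrA.
  over.
rewrite exchange_big /=; apply: eq_bigr => i _; rewrite mulr_sumr.
by apply: eq_bigr => j _; rewrite mxE.
Qed.

(** Ideals are subspaces: the rows of a matrix of maximal rank among those with
rows in the ideal (in coordinates along e) generate the ideal. *)
Lemma finite_algebra_noetherian : noetherian C.
Proof.
move=> I.
pose P r := `[< exists m (M : 'M[k]_(m, n)),
  (forall i, comb (row i M) \in I) /\ \rank M = r >].
have P0 : exists r, P r.
  exists (\rank (0 : 'M[k]_(0, n))); apply/asboolP; exists 0%N, 0; split=> //.
  by case.
have Pn r : P r -> (r <= n)%N.
  by move=> /asboolP[m [M [_ <-]]]; exact: rank_leq_col.
have [r /asboolP[m [M [MI rM]]] rmax] := ex_maxnP P0 Pn.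
exists [seq comb (row i M) | i <- enum 'I_m] => a.
have szE : size [seq comb (row i M) | i <- enum 'I_m] = m.
  by rewrite size_map size_enum_ord.
rewrite szE.
have nthE (i : 'I_m) :
    [seq comb (row i M) | i <- enum 'I_m]`_i = comb (row i M).
  by rewrite (nth_map i) ?size_enum_ord // nth_ord_enum.
split=> [aI|[c ->]]; last first.
  by apply: rpred_sum => i _; apply: idealMr; rewrite nthE.
have [v av] := combP a.
have /submxP[u vu] : (v <= M)%MS.
  apply: submx_trans (addsmxSl v M) _.
  rewrite -(geq_leqif (mxrank_leqif_sup (addsmxSr v M))) rM.
  apply: rmax; apply/asboolP; exists _, (col_mx v M).
  rewrite addsmxE; split=> // i; rewrite -[i]splitK; case: (split i) => j /=.
    by rewrite rowKu row_id -av.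
  by rewrite rowKd.
exists (fun i => oapp (fun i => kappa (u 0 i)) 0 (insub i)).
by rewrite av vu comb_mul; apply: eq_bigr => i _; rewrite nthE valK.
Qed.

Variable Lam : C -> k.
Hypothesis Lam_linear : forall a x y, Lam (kappa a * x + y) = a * Lam x + Lam y.
Hypothesis Lam_nondeg : forall x, (forall y, Lam (x * y) = 0) -> x = 0.

Let lin_sum (mu : C -> k) : (forall a x y, mu (kappa a * x + y) = a * mu x + mu y) ->
  forall m (c : 'I_m -> k) (f : 'I_m -> C),
  mu (\sum_i kappa (c i) * f i) = \sum_i c i * mu (f i).
Proof.
move=> hmu m c f.
have mu0 : mu 0 = 0.
  by have := hmu (-1) 0 0; rewrite mulr0 addr0 mulN1r addNr.
by elim/big_rec2: _ => //= i y x _ <-; rewrite hmu.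
Qed.

(** Every functional mu is Lam(b -): in coordinates this is a linear system with
the Gram matrix of e, solvable because any relation among the columns of the
Gram matrix is, by nondegeneracy, a relation among the e_i, and so holds for
the values mu(e_i). *)
Lemma frobenius_represent (mu : C -> k) :
  (forall a x y, mu (kappa a * x + y) = a * mu x + mu y) ->
  exists b, forall x, mu x = Lam (b * x).
Proof.
move=> hmu.
pose G := \matrix_(i < n, j < n) Lam (e i * e j).
pose v := \row_i mu (e i).
have /submxP[u vu] : (v <= G)%MS.
  rewrite submxE; apply/eqP/rowP => j; rewrite !mxE.
  have z : comb (col j (cokermx G))^T = 0.
    apply: Lam_nondeg => y; have [w ->] := combP y.
    rewrite mulrC /comb mulr_suml.
    under eq_bigr do rewrite -mulrA.
    rewrite (lin_sum Lam_linear) big1 // => i _; rewrite mulr_sumr.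
    under eq_bigr => l _ do rewrite mulrCA.
    rewrite (lin_sum Lam_linear).
    have := congr1 (fun M : 'M_n => M i j) (mulmx_coker G).
    rewrite !mxE => h; apply/eqP; rewrite mulf_eq0; apply/orP; right.
    by rewrite -[X in _ == X]h; apply/eqP/eq_bigr => l _; rewrite !mxE mulrC.
  have := lin_sum hmu ((col j (cokermx G))^T 0) e.
  rewrite -/(comb _) z (_ : mu 0 = 0); last first.
    by have := lin_sum hmu (fun _ : 'I_0 => 0) (fun=> 0); rewrite !big_ord0.
  by move=> h; rewrite [RHS]h; apply: eq_bigr => i _; rewrite !mxE mulrC.
exists (comb u) => x; have [w ->] := combP x.
rewrite {1}/comb (lin_sum hmu) mulrC /comb mulr_suml.
under [in RHS]eq_bigr do rewrite -mulrA.
rewrite (lin_sum Lam_linear); apply: eq_bigr => i _; congr (_ * _).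
rewrite mulr_sumr; under [in RHS]eq_bigr => l _ do rewrite mulrCA.
rewrite (lin_sum Lam_linear).
have := congr1 (fun M : 'rV_n => M 0 i) vu; rewrite !mxE => ->.
by apply: eq_bigr => l _; rewrite !mxE mulrC [e l * _]mulrC mulrC.
Qed.

End FiniteAlgebra.

Section Functional.
Local Open Scope classical_set_scope.
Variables (k : fieldType) (C : comNzRingType) (kappa : {rmorphism k -> C}).
Variables (M N : lmodType C) (u : {linear M -> N}) (f : M -> k).
Hypothesis u_inj : injective u.
Hypothesis f_linear : forall a x y, f (kappa a *: x + y) = a * f x + f y.

Definition linear_graph (G : set (N * k)) :=
  [/\ G (0, 0),
      forall a x y s t, G (x, s) -> G (y, t) -> G (kappa a *: x + y, a * s + t)
    & forall s, G (0, s) -> s = 0].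

Let graph0 : set (N * k) := [set z | exists x, z = (u x, f x)].

Let f0 : f 0 = 0.
Proof. by have := f_linear (-1) 0 0; rewrite scaler0 addr0 mulN1r addNr. Qed.

Let graph0_linear : linear_graph graph0.
Proof.
split.
- by exists 0; rewrite linear0 f0.
- move=> a _ _ _ _ [x [-> ->]] [y [-> ->]].
  by exists (kappa a *: x + y); rewrite linearP f_linear.
- by move=> s [x [ux ->]]; rewrite (u_inj (_ : u x = u 0)) ?linear0.
Qed.

(** Zorn's lemma on graphs of partial functionals.  The order is put on sets G
such that G joined with the graph of f is a linear graph, so that the empty
chain is bounded as well. *)
Lemma extend_functional : exists mu : N -> k,
  (forall a x y, mu (kappa a *: x + y) = a * mu x + mu y) /\
  forall x, mu (u x) = f x.
Proof.
pose P (G : set (N * k)) := linear_graph (G `|` graph0).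
have P0 : P set0 by rewrite /P set0U.
have [|G [PG Gmax]] := @Zorn_bigcup _ P.
  move=> F FP Ftot.
  have pick z : (\bigcup_(X in F) X `|` graph0) z ->
      exists2 X, F X \/ X = set0 & (X `|` graph0) z.
    case=> [[X FX Xz]|gz]; first by exists X; [left|left].
    by exists set0; [right|right].
  have PX X : F X \/ X = set0 -> P X by case=> [/FP|->].
  have sub X : F X \/ X = set0 ->
      X `|` graph0 `<=` \bigcup_(Y in F) Y `|` graph0.
    case=> [FX|->]; last by rewrite set0U => z; right.
    by apply: setSU => z Xz; exists X.
  split.
  - by right; case: graph0_linear.
  - move=> a x y s t /pick[X FX Xs] /pick[Y FY Yt].
    have [XY|YX] : X `<=` Y \/ Y `<=` X.
    + case: FX => [FX|->]; last by left.
      case: FY => [FY|->]; last by right.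
      exact: Ftot.
    + apply: (sub Y FY); case: (PX _ FY) => _ + _; apply => //.
      exact: setSU Xs.
    + apply: (sub X FX); case: (PX _ FX) => _ + _; apply => //.
      exact: setSU Yt.
  - by move=> s /pick[X FX Xs]; case: (PX _ FX) => _ _; apply.
set H := G `|` graph0 in PG *; case: (PG) => [H0 Hlin Hfun].
have Hneg x s : H (x, s) -> H (- x, - s).
  move=> Hx; have := Hlin (-1) _ _ _ _ Hx H0.
  by rewrite rmorphN1 scaleN1r mulN1r !addr0.
have Huniq x s t : H (x, s) -> H (x, t) -> s = t.
  move=> Hs /Hneg Ht; apply/eqP; rewrite -subr_eq0; apply/eqP/Hfun.
  by have := Hlin 1 _ _ _ _ Hs Ht; rewrite rmorph1 scale1r mul1r subrr.
have Htot v : exists s, H (v, s).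
  apply: contrapT => nv.
  (* G extended to the span of v by the value 0 at v *)
  pose G' : set (N * k) := [set z | exists x s c,
    H (x, s) /\ z = (kappa c *: v + x, s)].
  have HG' : H `<=` G'.
    by move=> [x s] Hx; exists x, s, 0; rewrite rmorph0 scale0r add0r.
  have G'U : G' `|` graph0 = G'.
    by apply/setUidPl => -[? ?] gz; apply: HG'; right.
  apply: (Gmax G').
    split; first by move=> [? ?] Gz; apply: HG'; left.
    move=> G'G; apply: nv; exists 0; left; apply: G'G.
    by exists 0, 0, 1; rewrite rmorph1 scale1r addr0.
  rewrite /P G'U; split.
  - exact: HG'.
  - move=> a _ _ _ _ [x [s [c [Hx [-> ->]]]]] [y [t [d [Hy [-> ->]]]]].
    exists (kappa a *: x + y), (a * s + t), (a * c + d).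
    split; first exact: Hlin.
    congr (_, _); rewrite rmorphD rmorphM scalerDl scalerDr scalerA.
    by rewrite addrACA.
  - move=> s [x [t [c [Hx [vx ->]]]]].
    have [c0|c0] := eqVneq c 0.
      by apply: Hfun; rewrite vx c0 rmorph0 scale0r add0r.
    case: nv; exists (- c^-1 * t).
    have := Hlin (- c^-1) _ _ _ _ Hx H0; rewrite !addr0.
    suff -> : kappa (- c^-1) *: x = v by [].
    have -> : x = - (kappa c *: v) by apply/eqP; rewrite -addr_eq0 addrC -vx.
    by rewrite scalerN rmorphN scaleNr opprK scalerA -rmorphM mulVf // rmorph1 scale1r.
have [mu hmu] := choice Htot.
exists mu; split=> [a x y|x].
  by apply: (Huniq _ _ _ (hmu _)); apply: Hlin; exact: hmu.
by apply: (Huniq _ _ _ (hmu _)); right; exists x.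
Qed.

End Functional.

Section Frobenius.
Variables (k : fieldType) (C : comNzRingType) (kappa : {rmorphism k -> C}).
Variables (n : nat) (e : 'I_n -> C).
Hypothesis e_span : forall x, exists c : 'I_n -> k, x = \sum_i kappa (c i) * e i.
Variable Lam : C -> k.
Hypothesis Lam_linear : forall a x y, Lam (kappa a * x + y) = a * Lam x + Lam y.
Hypothesis Lam_nondeg : forall x, (forall y, Lam (x * y) = 0) -> x = 0.

(** Lam turns C-linear maps N -> C into k-linear functionals on N, bijectively by
[frobenius_represent], and functionals extend from submodules. *)
Lemma frobenius_injective : injective_module (C^o : lmodType C).
Proof.
move=> M N u f u_inj.
have LamD x y : Lam (x + y) = Lam x + Lam y.
  by rewrite -[x]mul1r -(rmorph1 kappa) Lam_linear rmorph1 mul1r mul1r.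
have [a x y|mu [mu_lin mu_u]] :=
    @extend_functional k C kappa M N u (fun x => Lam (f x)) u_inj.
  by rewrite linearP; apply: Lam_linear.
have /choice[g hg] : forall z : N, exists b, forall x, mu (x *: z) = Lam (b * x).
  move=> z; apply: (frobenius_represent e_span Lam_linear Lam_nondeg) => a x y.
  by rewrite scalerDl -scalerA mu_lin.
have Lam_eq x y : (forall z, Lam (x * z) = Lam (y * z)) -> x = y.
  move=> h; apply/eqP; rewrite -subr_eq0; apply/eqP/Lam_nondeg => z.
  rewrite mulrBl addrC -mulN1r -(rmorphN1 kappa) Lam_linear h.
  by rewrite mulN1r addNr.
have g_lin : linear (g : N -> C^o).
  move=> a x y; apply: Lam_eq => z.
  have mu1 x' y' : mu (x' + y') = mu x' + mu y'.
    by rewrite -[x']scale1r -(rmorph1 kappa) mu_lin rmorph1 scale1r mul1r.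
  rewrite -hg scalerDr mu1 scalerA hg hg -LamD; congr Lam.
  rewrite /GRing.scale /=; ring.
pose gl : {linear N -> C^o} := HB.pack_for {linear N -> C^o} (g : N -> C^o)
  (GRing.isLinear.Build C N (C^o : lmodType C) _ _ g_lin).
exists gl => x; apply: Lam_eq => z /=.
rewrite -[RHS](_ : Lam (z *: f x) = _); last by rewrite /GRing.scale /= mulrC.
by rewrite -linearZ -mu_u linearZ hg.
Qed.

Lemma zero_module_injective : injective_module ('rV[C]_0 : lmodType C).
Proof.
move=> M N u f _; exists (\0 : {linear N -> 'rV[C]_0}) => x.
by apply/rowP; case.
Qed.

(** The injective resolution is C itself followed by zeros. *)
Lemma self_injective_dimension :
  injective_module (C^o : lmodType C) -> finite_injective_dimension (C^o : lmodType C).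
Proof.
move=> hC.
pose I i : lmodType C := if i is 0%N then (C^o : lmodType C) else ('rV[C]_0 : lmodType C).
pose d i : {linear I i -> I i.+1} := (\0 : {linear I i -> 'rV[C]_0}).
exists 0%N, I, (idfun : {linear C^o -> C^o}), d; split=> //.
- by case=> [|i]; [exact: hC|exact: zero_module_injective].
- by move=> y; split=> // _; exists y.
- move=> i y; split=> [_|//]; exists 0.
  by apply/rowP; case.
- by case=> // i _ x; apply/rowP; case.
Qed.

End Frobenius.

Lemma frobenius_gorenstein (k : fieldType) (C : comNzRingType)
    (kappa : {rmorphism k -> C}) (Lam : C -> k) :
  frobenius_algebra kappa Lam -> local_ring C -> gorenstein_local_ring C.
Proof.
move=> [[n [e e_span]] lin nondeg] hC; split=> //.
  exact: finite_algebra_noetherian e_span.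
exact: self_injective_dimension (frobenius_injective e_span lin nondeg).
Qed.

(** * Nilpotents and powers of sums *)

Section Nilpotent.
Variable A : comNzRingType.

Definition nilpotent (x : A) := exists n, x ^+ n = 0.

(** In the binomial expansion of (x + y)^(n + m) each term contains x^n or y^m. *)
Lemma nilpotent_ideal : is_ideal nilpotent.
Proof.
split; first by exists 1%N; rewrite expr1.
move=> a x y [n xn] [m ym]; exists (n + m)%N.
rewrite exprDn big1 // => i _.
have [im|im] := leqP m i.
  by rewrite -(subnK im) exprD ym !mulr0 mul0rn.
have -> : (n + m - i = n + (m - i))%N by lia.
by rewrite exprD exprMn xn mulr0 !mul0r mul0rn.
Qed.

Lemma unit_add_nilpotent (u x : A) : is_unit u -> nilpotent x -> is_unit (u + x).
Proof.
move=> [v uv] [n xn].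
have y0 : (- (v * x)) ^+ n = 0 by rewrite exprNn exprMn xn !mulr0.
exists (v * \sum_(i < n) (- (v * x)) ^+ i).
have -> : u + x = u * (1 - (- (v * x))) by rewrite opprK mulrDr mulr1 mulrA uv mul1r.
rewrite mulrACA uv mul1r.
by have := subrX1 (- (v * x)) n; rewrite y0 sub0r => /(congr1 -%R); rewrite opprK -mulNr opprB.
Qed.
End Nilpotent.

Section WittPolynomial.
Variable (p : nat).

(** The integral polynomial ((a + b)^p - a^p - b^p) / p, for p prime. *)
Definition witt (A : comNzRingType) (a b : A) : A :=
  \sum_(i < p.-1) ('C(p, i.+1) %/ p)%:R * (a ^+ i.+1 * b ^+ (p.-1 - i)).

Lemma rmorph_witt (A B : comNzRingType) (f : {rmorphism A -> B}) a b :
  f (witt a b) = witt (f a) (f b).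
Proof.
rewrite rmorph_sum; apply: eq_bigr => i _.
by rewrite !rmorphM !rmorphXn rmorph_nat.
Qed.

Lemma witt_divl (A : comNzRingType) (a b : A) : exists c, witt a b = a * c.
Proof.
exists (\sum_(i < p.-1) ('C(p, i.+1) %/ p)%:R * (a ^+ i * b ^+ (p.-1 - i))).
by rewrite mulr_sumr; apply: eq_bigr => i _; rewrite exprS; ring.
Qed.

Lemma witt_divr (A : comNzRingType) (a b : A) : exists c, witt a b = b * c.
Proof.
exists (\sum_(i < p.-1) ('C(p, i.+1) %/ p)%:R * (a ^+ i.+1 * b ^+ (p.-1 - i.+1))).
rewrite mulr_sumr; apply: eq_bigr => i _.
have -> : (p.-1 - i = (p.-1 - i.+1).+1)%N by have := ltn_ord i; lia.
by rewrite [b ^+ _.+1]exprS; ring.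
Qed.

Hypothesis p_prime : prime p.

Lemma exprD_prime (A : comNzRingType) (a b : A) :
  (a + b) ^+ p = a ^+ p + b ^+ p + p%:R * witt a b.
Proof.
have p0 := prime_gt0 p_prime.
rewrite addrC exprDn -(prednK p0) big_ord_recl big_ord_recr /= !prednK //.
rewrite subn0 bin0 mulr1 mulr1n.
rewrite [in X in _ = _ + X]/witt.
have -> : bump 0 p.-1 = p by rewrite /bump /= add1n prednK.
rewrite subnn binn mul1r mulr1n addrCA addrC; congr (_ + _); first by rewrite addrC.
rewrite mulr_sumr; apply: eq_bigr => i _.
rewrite /bump /= add1n; have hi := ltn_ord i.
have -> : (p - i.+1 = p.-1 - i)%N by lia.
rewrite mulrA -natrM mulnC divnK; last by apply: prime_dvd_bin => //; lia.
by rewrite mulr_natl [b ^+ _ * _]mulrC.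
Qed.

(** By induction (a + b)^(p^n) = a^(p^n) + b^(p^n) + p d for some d, and raising
to the power p makes the last summand contribute a multiple of p^2. *)
Lemma exprD_prime_power (A : comNzRingType) n (a b : A) : exists c,
  (a + b) ^+ (p ^ n.+1) = a ^+ (p ^ n.+1) + b ^+ (p ^ n.+1)
    + p%:R * witt (a ^+ (p ^ n)) (b ^+ (p ^ n)) + p%:R ^+ 2 * c.
Proof.
have step m : (exists d, (a + b) ^+ (p ^ m) =
    a ^+ (p ^ m) + b ^+ (p ^ m) + p%:R * d) ->
  exists c, (a + b) ^+ (p ^ m.+1) = a ^+ (p ^ m.+1) + b ^+ (p ^ m.+1)
    + p%:R * witt (a ^+ (p ^ m)) (b ^+ (p ^ m)) + p%:R ^+ 2 * c.
  move=> [d hd]; rewrite !expnSr !exprM hd exprD_prime.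
  have [f ->] := witt_divr (a ^+ (p ^ m) + b ^+ (p ^ m)) (p%:R * d).
  rewrite exprD_prime.
  have -> : (p%:R * d) ^+ p = p%:R ^+ 2 * (p%:R ^+ (p - 2) * d ^+ p).
    by rewrite exprMn mulrA -exprD subnKC // prime_gt1.
  by exists (p%:R ^+ (p - 2) * d ^+ p + d * f); ring.
elim: n => [|n [c hc]].
  by apply: step; exists 0; rewrite !expn0 !expr1; ring.
apply: step.
exists (witt (a ^+ (p ^ n)) (b ^+ (p ^ n)) + p%:R * c); rewrite hc; ring.
Qed.

(** Here M stands for the extension of the maximal ideal of the base and I for
that of an ideal separating p from 0.  The power (y0 + y1)^q is expanded in two
ways, the second time as (eps - y2)^q with eps = y0 + y1 + y2 in M, where all
summands lie in I; comparing gives p W in I. *)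
Lemma lift_relation (A : comNzRingType) (I M : A -> Prop) n
    (X : 'I_3 -> 'I_(p ^ n.+1) -> A) :
  is_ideal I -> is_ideal M -> M p%:R ->
  (forall x, M x -> I (p%:R * x)) -> (forall x, I (p%:R * x) -> M x) ->
  (forall f : 'I_(p ^ n.+1) -> A, (forall j, M (f j)) -> I (\prod_j f j)) ->
  (forall i j, M (X i j ^+ (p ^ n.+1))) ->
  M (\sum_i \prod_j X i j) ->
  M (witt ((\prod_j X ord0 j) ^+ (p ^ n)) ((\prod_j X (fintype.lift ord0 ord0) j) ^+ (p ^ n))).
Proof.
move=> hI hM Mp MI IM prodI Xq; set q := (p ^ n.+1)%N in X prodI Xq *.
pose Y i := \prod_j X i j; rewrite -/(Y ord0) -/(Y (fintype.lift ord0 ord0)) => hsum.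
have YI i : I (Y i ^+ q) by rewrite /Y -prodrXl; apply: prodI.
set y0 := Y ord0; set y1 := Y (fintype.lift ord0 ord0); apply: IM.
pose y2 := Y ord_max; pose eps := y0 + y1 + y2.
have eM : M eps.
  by move: hsum; rewrite !big_ord_recl big_ord0 addr0 addrA;
    congr (M (_ + _ + _)); apply: congr1; apply: val_inj.
have epsI : I (eps ^+ q).
  have := prodI (fun=> eps); rewrite prodr_const card_ord; apply=> _; exact: eM.
have [c hc] := exprD_prime_power n y0 y1.
have [d hd] := exprD_prime_power n eps (- y2).
have p2 z : I (p%:R ^+ 2 * z) by rewrite expr2 -mulrA; apply: MI; apply: ideal_mulr.
have e : (y0 + y1) ^+ q = (eps - y2) ^+ q by congr (_ ^+ _); rewrite /eps; ring.
have I1 : I ((y0 + y1) ^+ q).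
  rewrite e hd; apply: ideal_add => //; apply: ideal_add => //.
    apply: ideal_add => //; rewrite exprNn; apply: ideal_mull => //; exact: YI.
  have [f ->] := witt_divl (eps ^+ (p ^ n)) ((- y2) ^+ (p ^ n)).
  apply: MI; apply: ideal_mulr => //.
  have q0 : (0 < p ^ n)%N by rewrite expn_gt0 prime_gt0.
  by rewrite -(prednK q0) exprS; apply: ideal_mulr => //; apply: ideal_mulr.
rewrite (_ : _ * _ = (y0 + y1) ^+ q - y0 ^+ q - y1 ^+ q - p%:R ^+ 2 * c).
  by apply: ideal_sub => //; apply: ideal_sub => //; [apply: ideal_sub => // |]; exact: YI.
by rewrite hc; ring.
Qed.

End WittPolynomial.

(** * A Gorenstein algebra with a nonzero Witt obstruction *)

(** Macaulay's inverse systems.  A linear form on a polynomial ring, given by its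
values l on monomials and zero in high degree, defines a Frobenius algebra: the
quotient by the largest ideal in its kernel. *)
Section Macaulay.
Import mpoly.
Variables (k : fieldType) (n d : nat) (l : 'X_{1..n} -> k).
Hypothesis l_deg : forall m, (d <= mdeg m)%N -> l m = 0.

Definition pairing (P : {mpoly k[n]}) : k :=
  \sum_(m : 'X_{1..n < d}) P@_m * l m.

Lemma pairing_linear a P Q : pairing (a%:MP * P + Q) = a * pairing P + pairing Q.
Proof.
rewrite mulr_sumr -big_split /=; apply: eq_bigr => m _.
by rewrite mcoeffD mcoeffCM mulrDl mulrA.
Qed.

Lemma pairing0 : pairing 0 = 0.
Proof. by apply: big1 => m _; rewrite mcoeff0 mul0r. Qed.

Lemma pairingX m : pairing 'X_[m] = l m.
Proof.
rewrite /pairing; have [md|md] := ltnP (mdeg m) d; last first.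
  rewrite l_deg // big1 // => m' _; rewrite mcoeffX.
  case: eqP => [e|]; last by rewrite mul0r.
  by have := bmdeg m'; rewrite -e ltnNge md.
rewrite (bigD1 (BMultinom md)) //= mcoeffX eqxx mul1r big1 ?addr0 // => m' hm'.
rewrite mcoeffX; case: eqP => [e|]; last by rewrite mul0r.
by case/eqP: hm'; apply: val_inj.
Qed.

Definition annihilator (P : {mpoly k[n]}) := forall Q, pairing (P * Q) = 0.

Lemma annihilator_ideal : is_ideal annihilator.
Proof.
split; first by move=> Q; rewrite mul0r pairing0.
move=> a P Q hP hQ R.
have -> : (a * P + Q) * R = 1%:MP * (P * (a * R)) + Q * R.
  by rewrite mpolyC1; ring.
by rewrite pairing_linear hP hQ mulr0 addr0.
Qed.

(** The monomials of degree at least d vanish in the quotient, so that it is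
finite-dimensional and its elements without constant term are nilpotent. *)
Lemma macaulay : (exists m, l m != 0) ->
  exists (B : comNzRingType) (ev : {rmorphism {mpoly k[n]} -> B}) (Lam : B -> k),
  [/\ frobenius_algebra (ev \o mpolyC n (R := k)) Lam,
      forall m, Lam (ev 'X_[m]) = l m,
      forall x, (forall m, Lam (x * ev 'X_[m]) = 0) -> x = 0
    & forall b : B, is_unit b \/ nilpotent b].
Proof.
move=> [m0 lm0].
have proper : ~ annihilator 1.
  by move=> /(_ 'X_[m0]); rewrite mul1r pairingX; apply/eqP.
have [B [ev [ev_surj ev_ker]]] := quotient_ring annihilator_ideal proper.
have [lift liftK] := choice ev_surj.
pose Lam b := pairing (lift b).
have LamE P : Lam (ev P) = pairing P.
  have /ev_ker/(_ 1) : ev (lift (ev P) - P) = 0 by rewrite rmorphB liftK subrr.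
  rewrite mulr1 addrC -mulN1r -(mpolyC1 n k) -mpolyCN pairing_linear mulN1r.
  by move=> /eqP; rewrite addrC subr_eq0 => /eqP.
have Lam_lin a x y : Lam (ev a%:MP * x + y) = a * Lam x + Lam y.
  by rewrite -(liftK x) -(liftK y) -rmorphM -rmorphD !LamE pairing_linear.
have Lam0 : Lam 0 = 0 by rewrite -(rmorph0 ev) LamE pairing0.
have evE P : ev P = \sum_(m <- msupp P) ev (P@_m)%:MP * ev 'X_[m].
  rewrite {1}[P]mpolyE rmorph_sum; apply: eq_bigr => m _.
  by rewrite -rmorphM mul_mpolyC.
have Lam_eq0 x : (forall m, Lam (x * ev 'X_[m]) = 0) -> x = 0.
  move=> h; rewrite -(liftK x); apply/ev_ker => Q.
  rewrite -LamE rmorphM liftK evE mulr_sumr.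
  elim/big_rec: _ => // m y _ hy.
  by rewrite mulrCA Lam_lin h hy mulr0 addr0.
have evX0 m : (d <= mdeg m)%N -> ev 'X_[m] = 0.
  move=> dm; apply: Lam_eq0 => m'; rewrite -rmorphM -mpolyXD LamE pairingX.
  by apply: l_deg; rewrite mdegD (leq_trans dm) ?leq_addr.
exists B, ev, Lam; split=> //; [|by move=> m; rewrite LamE pairingX|]; last 1 first.
- move=> b; rewrite -(liftK b); move: (lift b) => P.
  have nilX m : m != 0%MM -> nilpotent (ev 'X_[m]).
    move=> m0'; exists d; rewrite -rmorphXn mpolyXn evX0 // mdegMn.
    by rewrite leq_pmull // lt0n mdeg_eq0.
  have nilP : nilpotent (ev P - ev (P@_0)%:MP).
    rewrite -rmorphB evE.
    apply: (@ideal_sum B (@nilpotent B) _ _ _ _ (@nilpotent_ideal B)) => m _.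
    have [->|m1] := eqVneq m 0%MM.
      rewrite mcoeffB mcoeffC eqxx mulr1 subrr rmorph0 mul0r.
      by case: (@nilpotent_ideal B).
    by apply: ideal_mull; [exact: nilpotent_ideal | exact: nilX].
  have [P0|P0] := eqVneq (P@_0) 0.
    by right; move: nilP; rewrite P0 rmorph0 subr0.
  left; rewrite -[ev P](subrKC (ev (P@_0)%:MP)).
  apply: unit_add_nilpotent => //; exists (ev ((P@_0)^-1)%:MP).
  by rewrite -rmorphM -mpolyCM mulfV // rmorph1.
split=> //=.
- pose N := #|{: 'X_{1..n < d}}|.
  exists N, (fun i : 'I_N => ev 'X_[enum_val i]) => x.
  rewrite -(liftK x) evE; move: (lift x) => P.
  pose sp x := exists c : 'I_N -> k, x = \sum_i ev (c i)%:MP * ev 'X_[enum_val i].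
  suff : sp (\sum_(m <- msupp P) ev (P@_m)%:MP * ev 'X_[m]) by [].
  elim/big_rec: _ => [|m y _ [c ->]].
    by exists (fun=> 0); rewrite big1 // => i _; rewrite !rmorph0 mul0r.
  have [md|md] := ltnP (mdeg m) d; last by rewrite evX0 // mulr0 add0r; exists c.
  pose i0 : 'I_N := enum_rank (BMultinom md).
  exists (fun i => (if i == i0 then P@_m else 0) + c i).
  under [RHS]eq_bigr => i _ do rewrite !rmorphD mulrDl.
  rewrite big_split /=; congr (_ + _).
  rewrite (bigD1 i0) //= eqxx big1 ?addr0 => [|i /negPf->]; last by rewrite !rmorph0 mul0r.
  by rewrite enum_rankK.
- move=> x h; apply: Lam_eq0 => m; exact: h.
Qed.

End Macaulay.

Section Weight.
Variables (k : fieldType) (q r : nat).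

(** The coefficient of u^r v^(q-r) in u^a v^b (-u-v)^c. *)
Definition weight (a b c : nat) : k :=
  if (a + b + c == q)%N && (a <= r)%N then (-1) ^+ c * 'C(c, r - a)%:R else 0.

(** The polynomials u, v and -u-v add up to 0. *)
Lemma weight_pascal a b c :
  weight a.+1 b c + weight a b.+1 c + weight a b c.+1 = 0.
Proof.
rewrite /weight addnS !addSn addnS.
case: eqP => [abc|_] /=; last by rewrite !addr0.
case: ltngtP => [ar|ar|<-].
- have -> : (r - a = (r - a.+1).+1)%N by lia.
  by rewrite binS natrD exprS; ring.
- by rewrite !addr0.
- by rewrite subnn !bin0 exprS; ring.
Qed.

End Weight.

Section Algebra.
Import mpoly.
Variables (k : fieldType) (p n : nat).
Hypothesis char_k : p \in [pchar k].
Local Notation q := (p ^ n.+1)%N.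
Local Notation r := (p ^ n)%N.

Let p_prime : prime p. Proof. exact: pcharf_prime char_k. Qed.
Let r_gt0 : (0 < r)%N. Proof. by rewrite expn_gt0 prime_gt0. Qed.
Let r_lt_q : (r < q)%N. Proof. by rewrite ltn_exp2l ?prime_gt1. Qed.
Let q_gt0 : (0 < q)%N. Proof. by rewrite expn_gt0 prime_gt0. Qed.

(** (u + v)^q = u^q + v^q in characteristic p has no term u^r v^(q-r). *)
Lemma bin_prime_power : 'C(q, r)%:R = 0 :> k.
Proof.
apply/eqP; rewrite -(dvdn_pcharf char_k).
have := mul_bin_diag q r.-1; rewrite prednK // [in X in X = _]expnSr -mulnA.
by move=> /eqP; rewrite eqn_pmul2l // => /eqP <-; exact: dvdn_mulr.
Qed.

Lemma weight_eq0 a b c : [|| (q <= a)%N, (q <= b)%N | (q <= c)%N] ->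
  weight k q r a b c = 0.
Proof.
move=> h; rewrite /weight; case: andP => // -[/eqP abc ar].
have [qc|qc] := leqP q c.
  have -> : c = q by lia.
  have -> : a = 0%N by lia.
  by rewrite subn0 bin_prime_power mulr0.
have -> : c = 0%N by lia.
have -> : a = 0%N by lia.
by rewrite subn0 bin_small ?mulr0.
Qed.

Let nv := #|{: 'I_3 * 'I_q}|.
Let v (i : 'I_3) (j : 'I_q) : 'I_nv := enum_rank (i, j).
Let j0 : 'I_q := Ordinal q_gt0.
Let i0 : 'I_3 := ord0.
Let i1 : 'I_3 := fintype.lift ord0 ord0.
Let i2 : 'I_3 := ord_max.

(** The monomials y_0^a y_1^b y_2^c, where y_i is the product over j of the
variables x_ij, are those whose exponents do not depend on j. *)
Definition diagonal (m : 'X_{1..nv}) :=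
  [forall i : 'I_3, forall j : 'I_q, m (v i j) == m (v i j0)].

Definition diag_weight (m : 'X_{1..nv}) : k :=
  if diagonal m then weight k q r (m (v i0 j0)) (m (v i1 j0)) (m (v i2 j0))
  else 0.

Lemma sum_ord3 (V : nmodType) (F : 'I_3 -> V) : \sum_i F i = F i0 + F i1 + F i2.
Proof.
rewrite !big_ord_recl big_ord0 addr0 addrA.
by congr (_ + _ + F _); apply: val_inj.
Qed.

Lemma diag_weight_deg m : ((q * q).+1 <= mdeg m)%N -> diag_weight m = 0.
Proof.
rewrite /diag_weight; case: ifP => // /forallP dm.
have -> : mdeg m = (q * \sum_i m (v i j0))%N.
  rewrite mdegE (reindex (fun ij : 'I_3 * 'I_q => v ij.1 ij.2)) /=; last first.
    exists (fun x => enum_val x) => x _; rewrite /v ?enum_rankK ?enum_valK //.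
      by case: x.
    by rewrite -surjective_pairing enum_valK.
  rewrite -(pair_bigA _ (fun i j => m (v i j))) /= big_distrr /=.
  apply: eq_bigr => i _; rewrite (eq_bigr (fun=> m (v i j0))).
    by rewrite sum_nat_const card_ord.
  by move=> j _; apply/eqP; have /forallP := dm i.
rewrite (sum_ord3 (fun i => m (v i j0))) /= /weight.
case: eqP => [e|//] /= h; exfalso; move: h.
by rewrite -[(_ + _ + _)%R]/(m (v i0 j0) + m (v i1 j0) + m (v i2 j0))%N e ltnn.
Qed.

Let y i : 'X_{1..nv} := (\sum_j U_(v i j))%MM.

Lemma block_mnmE i i' j : y i (v i' j) = (i == i').
Proof.
rewrite mnm_sumE (bigD1 j) //= mnm1E.
rewrite big1 ?addn0 => [|j' /negPf jj']; last first.
  by rewrite mnm1E (inj_eq enum_rank_inj) xpair_eqE jj' andbF.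
by rewrite (inj_eq enum_rank_inj) xpair_eqE eqxx andbT.
Qed.

Lemma diagonalD m i c : diagonal (m + y i *+ c) = diagonal m.
Proof.
apply: eq_forallb => i'; apply: eq_forallb => j.
by rewrite !mnmDE !mulmnE !block_mnmE eqn_add2r.
Qed.

(** The form [diag_weight] kills the multiples of x_ij^q by [weight_eq0] and those
of y_0 + y_1 + y_2 by [weight_pascal].  It takes the value 1 on W(y_0^r, y_1^r),
where only the term y_0^r y_1^(q-r), of coefficient binomial(p, 1) / p = 1,
contributes: the powers of y_0 in the others exceed r. *)
Lemma gorenstein_algebra :
  exists (B : comNzRingType) (kappa : {rmorphism k -> B}) (Lam : B -> k)
    (x : 'I_3 -> 'I_q -> B),
  [/\ frobenius_algebra kappa Lam,
      forall b : B, is_unit b \/ nilpotent b,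
      forall i j, x i j ^+ q = 0,
      \sum_i \prod_j x i j = 0
    & witt p ((\prod_j x ord0 j) ^+ r)
        ((\prod_j x (fintype.lift ord0 ord0) j) ^+ r) != 0].
Proof.
(* the monomial y_0^r y_1^(q-r) *)
have witness : diag_weight (y i0 *+ r + y i1 *+ (r * p.-1))%MM = 1.
  rewrite /diag_weight diagonalD -[(y i0 *+ r)%MM]add0m diagonalD.
  have -> : diagonal 0.
    by apply/forallP => i; apply/forallP => j; rewrite !mnmE.
  rewrite !mnmDE !mulmnE !block_mnmE !mnmE /= /weight.
  rewrite !mul1n !mul0n !addn0 add0n add0n leqnn subnn bin0 expr0 mulr1 andbT.
  by rewrite -mulnS prednK ?prime_gt0 // -expnSr eqxx.
have [|B [ev [Lam [frob LamX Lam_eq0 unit_nil]]]] := macaulay diag_weight_deg.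
  by exists (y i0 *+ r + y i1 *+ (r * p.-1))%MM; rewrite witness oner_eq0.
pose x i j := ev 'X_[U_(v i j)].
have prodx i : \prod_j x i j = ev 'X_[y i].
  by rewrite -rmorph_prod mprodXE.
have Lam0 : Lam 0 = 0.
  by have := frob_linear frob (-1) 0 0; rewrite mulr0 addr0 mulN1r addNr.
have LamD a b : Lam (a + b) = Lam a + Lam b.
  have := frob_linear frob 1 a b; by rewrite rmorph1 !mul1r.
exists B, (ev \o mpolyC nv (R := k)), Lam, x; split=> //.
- move=> i j; apply: Lam_eq0 => m.
  rewrite -rmorphXn mpolyXn -rmorphM -mpolyXD LamX /diag_weight.
  case: ifP => // /forallP/(_ i)/forallP/(_ j)/eqP h; apply: weight_eq0.
  have {h} : (q <= (U_(v i j) *+ q + m)%MM (v i j0))%N.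
    by rewrite -h mnmDE mulmnE mnm1E eqxx mul1n leq_addr.
  have : i \in [:: i0; i1; i2] by case: i => -[|[|[|]]].
  by rewrite !inE => /or3P[] /eqP -> ->; rewrite ?orbT.
- apply: Lam_eq0 => m; under eq_bigr do rewrite prodx.
  rewrite sum_ord3 !mulrDl !LamD -!rmorphM -!mpolyXD !LamX.
  rewrite ![(y _ + m)%MM]addmC -[y i0]mulm1n -[y i1]mulm1n -[y i2]mulm1n.
  rewrite /diag_weight !diagonalD; case: ifP => _; last by rewrite !addr0.
  rewrite !mnmDE !mulmnE !block_mnmE /= !addn0 !muln1 !addn1.
  exact: weight_pascal.
- rewrite !prodx -!rmorphXn -rmorph_witt; apply/eqP => w0.
  have : Lam (ev (witt p ('X_[y i0] ^+ r) ('X_[y i1] ^+ r))) = 1.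
    rewrite /witt rmorph_sum (big_morph Lam LamD Lam0).
    have p1 : (p.-1 = p.-2.+1)%N by have := prime_gt1 p_prime; lia.
    have LamZ c P : Lam (ev (c%:R * P)) = c%:R * Lam (ev P).
      have := frob_linear frob c%:R (ev P) 0.
      by rewrite !addr0 Lam0 addr0 /= mpolyC_nat rmorphM.
    have termE i : Lam (ev (('C(p, i.+1) %/ p)%:R * (('X_[y i0] ^+ r) ^+ i.+1 *
        ('X_[y i1] ^+ r) ^+ (p.-1 - i)))) =
        ('C(p, i.+1) %/ p)%:R *
        diag_weight (y i0 *+ (r * i.+1) + y i1 *+ (r * (p.-1 - i)))%MM.
      by rewrite LamZ -!exprM !mpolyXn -mpolyXD LamX.
    under eq_bigr do rewrite termE.
    rewrite p1 big_ord_recl big1 => [|i _] /=.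
      rewrite addr0 bin1 divnn prime_gt0 // mul1r muln1 subn0 -p1.
      exact: witness.
    rewrite /diag_weight; case: ifP => _; last by rewrite mulr0.
    rewrite /weight [X in _ && X](_ : _ = false) ?andbF ?mulr0 //.
    rewrite !mnmDE !mulmnE !block_mnmE /= mul1n mul0n addn0.
    by apply/negbTE; rewrite -ltnNge /bump /= add1n mulnS; nia.
  by rewrite w0 Lam0 => /eqP; rewrite eq_sym oner_eq0.
Qed.

End Algebra.

(** * The spectrum of an artinian local ring *)

Section ToLoc.
Variables (A : comNzRingType) (P : prime_idealr A).

Definition to_loc (a : A) : localization P := frac a (denom1 P).

Lemma to_loc_zmod : zmod_morphism to_loc.
Proof.
by move=> a b; rewrite /to_loc fracN fracD; apply: frac_eq => /=; ring.
Qed.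

Lemma to_loc_monoid : monoid_morphism to_loc.
Proof.
split; first exact: frac1.
by move=> a b; rewrite /to_loc fracM; apply: frac_eq => /=; ring.
Qed.

HB.instance Definition _ :=
  GRing.isZmodMorphism.Build A (localization P) to_loc to_loc_zmod.
HB.instance Definition _ :=
  GRing.isMonoidMorphism.Build A (localization P) to_loc to_loc_monoid.

Lemma frac_to_loc a s : frac a s * to_loc (den s) = to_loc a.
Proof. by rewrite /to_loc fracM; apply: frac_eq => /=; ring. Qed.

Lemma to_loc_unit a : is_unit (to_loc a) <-> a \notin P.
Proof. exact: frac_unit. Qed.

(** Localizing at elements that are already invertible changes nothing. *)
Lemma to_loc_bijective : (forall a, a \notin P -> is_unit a) -> bijective to_loc.
Proof.
move=> h.
have inj : injective to_loc.
  move=> a b /fracP[u /h[w uw] /=]; rewrite !mulr1 => e.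
  apply/eqP; rewrite -subr_eq0; apply/eqP.
  by rewrite -[LHS]mul1r -uw mulrAC e mul0r.
have /choice[g hg] : forall x, exists a, to_loc a = x.
  elim/fracW => a s; have [w sw] := h _ (denP s).
  exists (a * w); apply: frac_eq => /=.
  by rewrite mulr1 -mulrA [w * _]mulrC sw mulr1.
by exists g => // a; apply: inj.
Qed.

End ToLoc.

Lemma frobenius_transport (k : fieldType) (B C : comNzRingType)
    (kappa : {rmorphism k -> B}) (Lam : B -> k) (phi : {rmorphism B -> C}) :
  frobenius_algebra kappa Lam -> bijective phi ->
  exists Lam', frobenius_algebra (phi \o kappa) Lam'.
Proof.
move=> [[n [e espan]] lin nondeg] [psi psiK phiK].
have psiM x y : psi (x * y) = psi x * psi y.
  by apply: (can_inj psiK); rewrite rmorphM !phiK.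
exists (Lam \o psi); split.
- exists n, (phi \o e) => x; have [c hc] := espan (psi x).
  exists c; rewrite -[x]phiK hc rmorph_sum; apply: eq_bigr => i _.
  by rewrite rmorphM.
- move=> a x y /=; rewrite -lin; congr Lam.
  by apply: (can_inj psiK); rewrite rmorphD rmorphM !phiK.
- move=> x h; rewrite -[x]phiK (nondeg (psi x)) ?rmorph0 // => y.
  by rewrite -(psiK y) -psiM; apply: h.
Qed.

Lemma spec_eq (A : comNzRingType) (P Q : spec A) : pideal P =1 pideal Q -> P = Q.
Proof.
case: P Q => [P P1 P2] [Q Q1 Q2] /= /funext PQ.
by subst Q; rewrite (Prop_irrelevance P1 Q1) (Prop_irrelevance P2 Q2).
Qed.

(** The closed point of the spectrum of a local ring. *)
Section NonunitPoint.
Variables (A : comNzRingType).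
Hypothesis nonunitD : forall x y : A, is_unit (x + y) -> is_unit x \/ is_unit y.

Let nonunit : A -> bool := fun x => `[< ~ is_unit x >].

Let nonunitP : idealr_closed nonunit.
Proof.
have E x : (x \in (nonunit : pred A)) = `[< ~ is_unit x >] by [].
split; rewrite ?E.
- by apply/asboolP => -[y]; rewrite mul0r => /eqP; rewrite eq_sym oner_eq0.
- by apply/negP => /asboolP; apply; exists 1; rewrite mulr1.
- move=> a x y; rewrite !E => /asboolP nx /asboolP ny; apply/asboolP.
  move=> /nonunitD[[z axz]|//]; apply: nx; exists (a * z).
  by rewrite mulrA [x * a]mulrC.
Qed.

Let nonunit_prime : prime_idealr_closed nonunit.
Proof.
have E x : (x \in (nonunit : pred A)) = `[< ~ is_unit x >] by [].
move=> x y; rewrite !E => /asboolP nxy; apply/orP.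
apply: contrapT => /not_orP[/negP/asboolPn/contrapT[x' xx']].
move=> /negP/asboolPn/contrapT[y' yy'].
by apply: nxy; exists (x' * y'); rewrite mulrACA xx' yy' mulr1.
Qed.

Definition nonunit_point : spec A := SpecPoint nonunitP nonunit_prime.

Lemma nonunit_pointP x : (x \in pideal nonunit_point) <-> ~ is_unit x.
Proof. by split=> [/asboolP|?]; [|apply/asboolP]. Qed.

Lemma nonunit_point_max (P : spec A) x :
  x \in pideal P -> x \in pideal nonunit_point.
Proof.
move=> xP; apply/nonunit_pointP => -[y xy].
by have := idealr1 (pideal P); rewrite -xy mulrC idealMr.
Qed.

End NonunitPoint.

Section ArtinianLocal.
Variable B : comNzRingType.
Hypothesis unit_nil : forall b : B, is_unit b \/ nilpotent b.

Lemma nilpotent_nonunit (x : B) : nilpotent x -> ~ is_unit x.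
Proof.
move=> [n xn] [y xy]; have : (x * y) ^+ n = 0 by rewrite exprMn xn mul0r.
by rewrite xy expr1n; apply/eqP; rewrite oner_eq0.
Qed.

(** Units lie in no prime ideal and nilpotents in all of them, so the nilpotents
form the only prime ideal. *)
Lemma prime_nilpotent (P : spec B) x : (x \in pideal P) <-> nilpotent x.
Proof.
split=> [xP|[n xn]].
  have [[y xy]|//] := unit_nil x.
  by have := idealr1 (pideal P); rewrite -xy mulrC idealMr.
have : x ^+ n \in pideal P by rewrite xn idealr0.
elim: n {xn} => [|n IH]; first by rewrite expr0 idealr1.
by rewrite exprS prime_idealrM => /orP[].
Qed.

Lemma artinian_point_eq (P Q : spec B) : P = Q.
Proof.
apply: spec_eq => x; apply/idP/idP => h.
  by apply/(prime_nilpotent Q)/(prime_nilpotent P).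
by apply/(prime_nilpotent P)/(prime_nilpotent Q).
Qed.

Lemma artinian_point : exists P : spec B, True.
Proof.
suff h : forall x y : B, is_unit (x + y) -> is_unit x \/ is_unit y.
  by exists (nonunit_point h).
move=> x y uxy; have [|nx] := unit_nil x; first by left.
right; have [//|ny] := unit_nil y.
by case: (nilpotent_nonunit (ideal_add (@nilpotent_ideal B) nx ny)).
Qed.

Lemma artinian_dimension : has_dimension (Spec B) 0.
Proof.
have [P _] := artinian_point.
have pt (x y : Spec B) : x = y by exact: artinian_point_eq.
split.
  exists (fun=> setT); split=> // i _; split; [exact: closedT|by exists P|].
  move=> F G _ _ /(_ P I)[FP|GP]; [left|right] => x _.
    by rewrite (pt x P).
  by rewrite (pt x P).
move=> [Z [Zirr Zlt]]; have [_ [x Zx] _] := Zirr 0%N isT.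
have [_] := Zlt 0%N isT; apply=> y _.
by rewrite (pt y x).
Qed.

Lemma artinian_to_loc_bijective (x : spec B) : bijective (to_loc (pideal x)).
Proof.
apply: to_loc_bijective => a ax; have [//|na] := unit_nil a.
by move: ax; have -> : a \in pideal x by apply/prime_nilpotent.
Qed.

(** The localization at the only point is the ring itself, and the Frobenius
structure moves across this isomorphism. *)
Lemma artinian_gorenstein (k : fieldType) (kappa : {rmorphism k -> B}) Lam :
  frobenius_algebra kappa Lam -> gorenstein_scheme (Spec B).
Proof.
move=> frob; split=> [x|x].
  have [n [e espan]] := frob_span frob.
  exists B, (mor_id _); split; first exact: finite_algebra_noetherian espan.
    by split=> [y z //|U|y]; [rewrite image_id|exists id].
  by exists x.
have bij := artinian_to_loc_bijective x.
have [Lam' frob'] := frobenius_transport (phi := to_loc (pideal x)) frob bij.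
exact: frobenius_gorenstein frob' (localization_local _).
Qed.

End ArtinianLocal.

(** * The local ring of a lift *)

Section EqMor.

Lemma eq_mor_sym (X Y : lrs) (f g : mor X Y) : eq_mor f g -> eq_mor g f.
Proof. by move=> [h1 h2]; split=> x *; rewrite ?h1 ?h2. Qed.

Lemma eq_mor_trans (X Y : lrs) (f g h : mor X Y) :
  eq_mor f g -> eq_mor g h -> eq_mor f h.
Proof.
by move=> [h1 h2] [h3 h4]; split=> x *; rewrite ?h1 ?h2.
Qed.

Lemma eq_mor_compl (X Y Z : lrs) (g : mor Y Z) (f f' : mor X Y) :
  eq_mor f f' -> eq_mor (mor_comp g f) (mor_comp g f').
Proof.
move=> [h1 h2]; split=> [x|x t] /=; first by rewrite h1.
exact: (h2 x (fun y => mor_stalk g y (t (g y)))).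
Qed.

Lemma eq_mor_compr (X Y Z : lrs) (g g' : mor Y Z) (f : mor X Y) :
  eq_mor g g' -> eq_mor (mor_comp g f) (mor_comp g' f).
Proof.
by move=> [h1 h2]; split=> [x|x t] /=; rewrite ?h1 ?h2.
Qed.

End EqMor.

(** Transport of a value of a family of germs along an equality of points, without
casts: only numerator and denominator are compared. *)
Lemma family_frac (A : comNzRingType) (P Q : spec A)
    (s : forall p : spec A, localization (pideal p)) a d :
  P = Q -> s P = frac a d -> exists2 d' : denom (pideal Q), den d' = den d & s Q = frac a d'.
Proof. by move=> PQ; subst Q => ->; exists d. Qed.

Lemma is_unit_rmorph (A B : comNzRingType) (phi : {rmorphism A -> B}) a :
  is_unit a -> is_unit (phi a).
Proof. by move=> [b ab]; exists (phi b); rewrite -rmorphM ab rmorph1. Qed.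

Lemma is_unit_cancel (A : comNzRingType) (u a b : A) :
  is_unit u -> a * u = b * u -> a = b.
Proof.
by move=> [v uv] e; rewrite -[a]mulr1 -[b]mulr1 -uv !mulrA e.
Qed.

Lemma sec_global (A : comNzRingType) (r : A) :
  sec (Spec A) setT (fun P : Spec A => to_loc (pideal P) r).
Proof.
move=> P _; exists setT; split=> //; first exact: openT.
exists r, 1 => Q _; have Q1 : 1 \notin pideal Q by rewrite idealr1.
by exists Q1; apply: frac_eq.
Qed.

Section LocalSource.
Variables (E R : comNzRingType).
Hypothesis nonunitD : forall x y : E, is_unit (x + y) -> is_unit x \/ is_unit y.
Let t0 : Spec E := nonunit_point nonunitD.

(** A morphism F from a local scheme to Spec R is determined by the images of the
elements of R in the stalk at the closed point t0.  Indeed each r in R pulls back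
to a global section, two global sections with the same germ at t0 agree on an
open set containing t0, and such a set is the whole space.  So the pullbacks of r
agree in every stalk; the points F(t) are recovered as the r whose pullback at t
is not a unit, and the maps on stalks by passing to fractions. *)
Lemma local_mor_eq (F G : mor (Spec E) (Spec R)) :
  (forall r, mor_stalk F t0 (to_loc (pideal (F t0)) r) =
             mor_stalk G t0 (to_loc (pideal (G t0)) r)) ->
  eq_mor F G.
Proof.
move=> h0.
have h r t : mor_stalk F t (to_loc (pideal (F t)) r) =
             mor_stalk G t (to_loc (pideal (G t)) r).
  have sF := mor_sec F (@openT _) (sec_global r).
  have sG := mor_sec G (@openT _) (sec_global r).
  have [V [oV Vt0 _ FG]] := germ_eq (@openT _) sF sG I (h0 r).
  apply: FG; case: oV Vt0 => Ev -> [a Ea at0]; exists a => //.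
  by apply: contra at0; exact: nonunit_point_max.
have FG t : F t = G t.
  apply: spec_eq => r; apply/idP/idP; apply: contraLR => rP.
    have : is_unit (mor_stalk F t (to_loc (pideal (F t)) r)).
      by rewrite h; apply: is_unit_rmorph; apply/to_loc_unit.
    by move=> /mor_local/to_loc_unit.
  have : is_unit (mor_stalk G t (to_loc (pideal (G t)) r)).
    by rewrite -h; apply: is_unit_rmorph; apply/to_loc_unit.
  by move=> /mor_local/to_loc_unit.
split=> // t s.
have [a [d sF]] : exists a d, s (F t) = frac a d.
  by exists (loc_num (s (F t))), (loc_den (s (F t))); rewrite loc_numden.
have [d' dd' sG] := family_frac (s := s) (FG t) sF.
rewrite sF sG; apply: (is_unit_cancel (u := mor_stalk F t (to_loc (pideal (F t)) (den d)))).
  by apply: is_unit_rmorph; apply/to_loc_unit; exact: denP.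
rewrite -rmorphM frac_to_loc h [in RHS]h -dd' -rmorphM frac_to_loc //.
Qed.

End LocalSource.

Lemma factor_rmorphism (R k E : comNzRingType) (pi : {rmorphism R -> k})
    (rho : {rmorphism R -> E}) :
  (forall y, exists x, pi x = y) -> (forall x, pi x = 0 -> rho x = 0) ->
  exists b : {rmorphism k -> E}, forall x, b (pi x) = rho x.
Proof.
move=> /choice[s sK] h.
have hE x y : pi x = pi y -> rho x = rho y.
  move=> e; apply/eqP; rewrite -subr_eq0 -rmorphB; apply/eqP/h.
  by rewrite rmorphB e subrr.
pose b0 y := rho (s y).
have b0_zmod : zmod_morphism b0.
  by move=> x y; rewrite /b0 -rmorphB; apply: hE; rewrite rmorphB !sK.
have b0_mon : monoid_morphism b0.
  split; first by rewrite /b0 -(rmorph1 rho); apply: hE; rewrite sK rmorph1.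
  by move=> x y; rewrite /b0 -rmorphM; apply: hE; rewrite rmorphM !sK.
pose b : {rmorphism k -> E} := HB.pack_for {rmorphism k -> E} b0
  (GRing.isZmodMorphism.Build k E b0 b0_zmod)
  (GRing.isMonoidMorphism.Build k E b0 b0_mon).
by exists b => x; apply: hE; rewrite sK.
Qed.

Lemma extend_bij (R A A' : comNzRingType) (gamma : {rmorphism R -> A})
    (phi : {rmorphism A -> A'}) (J : R -> Prop) a : bijective phi ->
  extend (phi \o gamma) J (phi a) -> extend gamma J a.
Proof.
move=> [psi phiK psiK] [n [c [d [hc e]]]]; exists n, c, (psi \o d); split=> //.
apply: (can_inj phiK); rewrite e rmorph_sum; apply: eq_bigr => i _ /=.
by rewrite rmorphM psiK.
Qed.

Lemma local_nonunitD (A : comNzRingType) (P : prime_idealr A) (x y : localization P) :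
  is_unit (x + y) -> is_unit x \/ is_unit y.
Proof.
move=> uxy; apply: contrapT => /not_orP[nx ny].
suff : x + y \in (loc_max (p:=P) : pred _) by move=> /asboolP.
by apply: rpredD; apply/asboolP.
Qed.

Section LocalQuotient.
Variables (O E : comNzRingType) (be : {rmorphism O -> E}).
Hypothesis nonunitD : forall x y : O, is_unit (x + y) -> is_unit x \/ is_unit y.
Hypothesis be_surj : forall y, exists x, be x = y.

Lemma local_quotient_unit x : is_unit (be x) -> is_unit x.
Proof.
move=> [y xy]; have [z zy] := be_surj y.
have [[w hw]|[w hw]] : is_unit (x * z) \/ is_unit (1 - x * z).
- by apply: nonunitD; exists 1; ring.
- by exists (z * w); rewrite mulrA.
have : be ((1 - x * z) * w) = 0.
  by rewrite rmorphM rmorphB rmorphM rmorph1 zy xy subrr mul0r.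
by rewrite hw rmorph1 => /eqP; rewrite oner_eq0.
Qed.

Lemma local_quotient_nonunitD (x y : E) :
  is_unit (x + y) -> is_unit x \/ is_unit y.
Proof.
have [x' <-] := be_surj x; have [y' <-] := be_surj y.
rewrite -rmorphD => /local_quotient_unit/nonunitD[h|h]; [left|right];
  exact: is_unit_rmorph.
Qed.

End LocalQuotient.

Section LiftStalk.
Variables (R : comNzRingType) (k : fieldType) (pi : {rmorphism R -> k}).
Hypothesis pi_surj : forall y, exists x, pi x = y.
Hypothesis pi_unit : forall r, pi r != 0 -> is_unit r.
Variables (X : scheme) (f : mor X (Spec k)) (x0 : X).
Hypothesis X_point : forall x : X, x = x0.

Definition base_map (Xt : lrs) (g : mor Xt (Spec R)) (y : Xt) :
  {rmorphism R -> stalk Xt y} :=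
  mor_stalk g y \o to_loc (pideal (g y)).

(** X itself plays the role of the fibre product of Xt and Spec k over Spec R. *)
Section Lift.
Variables (Xt : scheme) (g : mor Xt (Spec R)) (i : mor X Xt).
Hypothesis comm : eq_mor (mor_comp g i) (mor_comp (Spec_map pi) f).
Hypothesis univ : forall (T : scheme) (a : mor T Xt) (b : mor T (Spec k)),
  eq_mor (mor_comp g a) (mor_comp (Spec_map pi) b) ->
  exists h : mor T X, eq_mor (mor_comp i h) a.

Let mX (y : Xt) : stalk Xt y -> Prop :=
  extend (base_map g y) (fun r => pi r = 0).

(** The composite R -> stalk of Xt -> stalk of X factors through k. *)
Lemma base_map_ker r : pi r = 0 -> mor_stalk i x0 (base_map g (i x0) r) = 0.
Proof.
move=> r0; have := comm.2 x0 (fun y => to_loc (pideal y) r) => /= ->.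
rewrite /to_loc; apply: etrans (congr1 _ (loc_mapE _ _)) _.
rewrite r0 (_ : frac 0 _ = 0) ?rmorph0 //.
by rewrite -frac0; apply: frac_eq; rewrite !mul0r.
Qed.

Lemma lift_point r : r \in pideal (g (i x0)) <-> pi r = 0.
Proof.
have -> : g (i x0) = Spec_map pi (f x0) by exact: comm.1.
have -> : (r \in pideal (Spec_map pi (f x0))) = (pi r \in pideal (f x0)) by [].
split=> [h|->]; last by rewrite idealr0.
apply/eqP; apply: contraTT h => pir0; apply/negP => h.
by have := idealr1 (pideal (f x0)); rewrite -(mulVf pir0) idealMr.
Qed.

Lemma stalk_ideal_proper : ~ mX (1 : stalk Xt (i x0)).
Proof.
move=> h; suff : mor_stalk i x0 1 = 0 by rewrite rmorph1; apply/eqP; rewrite oner_eq0.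
by apply: (extend_sub (rmorph_ker_ideal (mor_stalk i x0))) h; exact: base_map_ker.
Qed.

(** Let O be the stalk of Xt at i(x0), computed in an affine chart Spec A around
that point, and E = O / mO.  The morphism Spec E -> Spec A -> Xt and the one
induced by k -> E agree over Spec R, by [local_mor_eq], so that Spec E -> Xt
factors through i.  Hence what dies in the stalk of X dies in the stalk of
Spec E at its closed point, which is E. *)
Lemma stalk_kernel c : mor_stalk i x0 c = 0 -> mX c.
Proof.
move=> c0.
have [A [j [[_ _ jbij] [q jq]]]] := scheme_affine (i x0).
pose psi : {rmorphism R -> localization (pideal q)} := mor_stalk j q \o base_map g (j q).
have proper : ~ extend psi (fun r => pi r = 0) 1.
  move=> h; have : mX (1 : stalk Xt (j q)).
    by apply: (extend_bij (jbij q)); rewrite rmorph1.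
  by rewrite jq; exact: stalk_ideal_proper.
have [E [be [be_surj be_ker]]] := quotient_ring (extend_ideal _ _) proper.
pose phi : {rmorphism A -> E} := be \o to_loc (pideal q).
have Onu := @local_nonunitD A (pideal q).
have Enu := local_quotient_nonunitD Onu be_surj.
pose t0 : Spec E := nonunit_point Enu.
(* the closed point of Spec E lies over the point q of the chart *)
have phi_t0 : Spec_map phi t0 = q.
  apply: spec_eq => a; apply/idP/idP; apply: contraLR => ha.
    apply/negP => /(nonunit_pointP Enu); apply; apply: (is_unit_rmorph be).
    exact/to_loc_unit.
  apply/negP => haq; case/negP: ha; apply/(nonunit_pointP Enu).
  by move=> /(local_quotient_unit Onu be_surj)/to_loc_unit/negP; apply.
have stalk_phi (Z : forall p : spec A, localization (pideal p)) :
    mor_stalk (Spec_map phi) t0 (Z (Spec_map phi t0)) =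
    to_loc (pideal t0) (be (Z q)).
  set z := Z (Spec_map phi t0).
  have [d' dd' Zq] := family_frac (s := Z) phi_t0 (esym (loc_numden z)).
  rewrite -(loc_numden z) Zq.
  apply: etrans (loc_mapE _ _) _; apply: frac_eq => /=.
  by rewrite mulr1 -dd' -rmorphM frac_to_loc.
have [b hb] : exists b : {rmorphism k -> E}, forall r, b (pi r) = be (psi r).
  apply: (@factor_rmorphism R k E pi (be \o psi) pi_surj) => r r0.
  by apply/be_ker/extend_gen.
pose a := mor_comp j (Spec_map phi).
have [|h [_ hstalk]] := @univ (Spec E) a (Spec_map b).
  refine (@local_mor_eq E R Enu (mor_comp g a) (mor_comp (Spec_map pi) (Spec_map b)) _) => r.
  apply: etrans (stalk_phi (fun p => mor_stalk j p (base_map g (j p) r))) _.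
  rewrite -[mor_stalk j q _]/(psi r) -hb.
  apply: esym; apply: etrans (congr1 _ (loc_mapE _ _)) _.
  by apply: etrans (loc_mapE _ _) _; apply: frac_eq => /=; rewrite !rmorph1.
(* c is extended to a family of germs, the form in which equality of
   morphisms is expressed *)
have [_ [s [_ _ _ sc]]] := germ_ex c.
have := hstalk t0 s => /=.
have -> : mor_stalk i (h t0) (s (i (h t0))) = 0.
  by rewrite (X_point (h t0)) sc.
rewrite rmorph0 => /esym hz.
have : be (mor_stalk j q (s (j q))) = 0.
  have inj : injective (to_loc (pideal t0)).
    apply/bij_inj/to_loc_bijective => e et0; apply: contrapT => ne.
    by move/negP: et0; apply; apply/(nonunit_pointP Enu).
  apply: inj; rewrite rmorph0.
  exact: etrans (esym (stalk_phi (fun p => mor_stalk j p (s (j p))))) hz.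
move=> /be_ker/(extend_bij (jbij q)) => hm.
have : mX (s (j q)) by [].
by rewrite jq sc.
Qed.
End Lift.

(** The commutative algebra behind a lift.  S is the local ring of Spec R at the
image of x0, which is R again, and A is the local ring of the lift. *)
Lemma lift_stalk : liftable pi f ->
  exists (S A : comNzRingType) (iota : {rmorphism R -> S})
    (gamma : {rmorphism S -> A}) (sigma : {rmorphism A -> stalk X x0}),
  [/\ flat_hom gamma, bijective iota, forall y, exists x, sigma x = y
    & forall c, sigma c = 0 <-> extend (gamma \o iota) (fun r => pi r = 0) c].
Proof.
move=> [Xt [g [i [flat [_ _ i_surj] [P [pX [pk [u [[sq univ] ui uf [v [vu uv]]]]]]]]]]].
have comm : eq_mor (mor_comp g i) (mor_comp (Spec_map pi) f).
  apply: eq_mor_trans (eq_mor_compl g (eq_mor_sym ui)) _.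
  apply: eq_mor_trans (eq_mor_compr u sq) _.
  exact: eq_mor_compl uf.
have univX (T : scheme) (a : mor T Xt) (b : mor T (Spec k)) :
    eq_mor (mor_comp g a) (mor_comp (Spec_map pi) b) ->
    exists h : mor T X, eq_mor (mor_comp i h) a.
  move=> /univ[h [ha _ _]]; exists (mor_comp v h).
  apply: eq_mor_trans (eq_mor_compr (mor_comp v h) (eq_mor_sym ui)) _.
  apply: eq_mor_trans ha; apply: (eq_mor_compl pX (f := mor_comp (mor_comp u v) h)).
  exact: eq_mor_compr uv.
exists (localization (pideal (g (i x0)))), (stalk Xt (i x0)),
  (to_loc (pideal (g (i x0)))), (mor_stalk g (i x0)), (mor_stalk i x0).
split.
- exact: flat.
- apply: to_loc_bijective => r rP; apply: pi_unit; apply/eqP => r0.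
  by case/negP: rP; apply/(lift_point comm).
- exact: i_surj.
- move=> c; split; first exact: stalk_kernel.
  by apply: (extend_sub (rmorph_ker_ideal (mor_stalk i x0))); exact: base_map_ker.
Qed.

End LiftStalk.

(** * Non-liftability *)

Unset Implicit Arguments.

Theorem theorem0p1 (R : comNzRingType) (k : fieldType)
    (pi : {rmorphism R -> k}) (p : nat)
    (R_noetherian : noetherian R) (R_local : local_ring R)
    (pi_surjective : forall y : k, exists x : R, pi x = y)
    (char_k : p \in [pchar k])
    (pR_neq0 : exists r : R, p%:R * r != 0) :
  exists (X : scheme) (f : mor X (Spec k)),
    [/\ has_dimension X 0%N, gorenstein_scheme X & ~ liftable pi f].
Proof.
have p_prime := pcharf_prime char_k.
have pi_p : pi p%:R = 0 by rewrite rmorph_nat pcharf0.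
have p_neq0 : p%:R != 0 :> R.
  by case: pR_neq0 => r; apply: contraNneq => ->; rewrite mul0r.
have [I [hI _ pI [e [s [a [aI ka]]]]]] :=
  separating_ideal R_noetherian R_local pi_surjective pi_p p_neq0.
(* so that, in any R-algebra A, products of p^(n+1) elements of mA lie in IA *)
have [n hn] : exists n, (s * e < p ^ n.+1)%N.
  exists (s * e)%N; apply: leq_trans (ltn_expl _ (prime_gt1 p_prime)) _.
  by rewrite leq_exp2l ?prime_gt1.
have [B [kappa [Lam [x [frob unit_nil xq sumx wx]]]]] :=
  gorenstein_algebra n char_k.
exists (Spec B), (Spec_map kappa); split.
- exact: artinian_dimension.
- exact: artinian_gorenstein frob.
have [x0 _] := artinian_point unit_nil.
move=> /(lift_stalk pi_surjective
  (local_unit R_noetherian R_local pi_surjective)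
  (X := Spec B) (x0 := x0) (fun y => artinian_point_eq unit_nil y x0)).
move=> [S [A [iota [gamma [sigma [flat iota_bij sigma_surj ker]]]]]].
set rho := gamma \o iota : {rmorphism R -> A}.
have proper : ~ extend rho (fun r => pi r = 0) 1.
  by move=> /ker; rewrite rmorph1; apply/eqP; rewrite oner_eq0.
have [X hX] : exists X : 'I_3 -> 'I_(p ^ n.+1) -> A,
    forall i j, sigma (X i j) = to_loc (pideal x0) (x i j).
  have [lft lftK] := choice sigma_surj.
  by exists (fun i j => lft (to_loc (pideal x0) (x i j))).
have prodX i : sigma (\prod_j X i j) = to_loc (pideal x0) (\prod_j x i j).
  by rewrite !rmorph_prod; apply: eq_bigr.
have rho_p : rho p%:R = p%:R by rewrite rmorph_nat.
have wM := lift_relation p_prime (n := n) (X := X)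
  (extend_ideal rho I) (extend_ideal rho (fun r => pi r = 0)).
have : sigma (witt p ((\prod_j X ord0 j) ^+ (p ^ n))
                 ((\prod_j X (lift ord0 ord0) j) ^+ (p ^ n))) = 0.
  apply/ker/wM.
  - by rewrite -rho_p; apply: extend_gen.
  - move=> _ [m [c [d [hc ->]]]]; exists m, (fun i => p%:R * c i), d.
    split=> [i|]; first exact/pI.
    by rewrite mulr_sumr; apply: eq_bigr => i _; rewrite rmorphM rho_p mulrA.
  - move=> y; rewrite -rho_p.
    exact: (flat_divide_iso (t := p%:R) flat iota_bij hI (rmorph_ker_ideal pi) pI proper).
  - by move=> f; apply: extend_prod hI aI _ hn => y /ka.
  - by move=> i j; apply/ker; rewrite rmorphXn hX -rmorphXn xq rmorph0.
  - apply/ker; rewrite rmorph_sum.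
    by under eq_bigr do rewrite prodX; rewrite -rmorph_sum sumx rmorph0.
rewrite rmorph_witt !rmorphXn !prodX -!rmorphXn -rmorph_witt.
rewrite -(rmorph0 (to_loc (pideal x0))).
move=> /(bij_inj (artinian_to_loc_bijective unit_nil x0)) w0.
by rewrite w0 eqxx in wx.
Qed.
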